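(* Let $\mathsf{s}=\mathrm{diag}(1,0,\ldots,0)\in\mathfrak{gl}_n(\mathbb{C})$ and let $h:[n]\to[n]$ be a Hessenberg function with corner set $\mathcal{C}(h)$. The matrix Hessenberg scheme $\mathcal{Y}_{\mathsf{s},h}$ is a reduced union of matrix Richardson schemes: $$\mathcal{Y}_{\mathsf{s},h}=\bigcup_{i\in\mathcal{C}(h)}\left(\mathcal{X}_{u[i]}^{\mathrm{op}}\cap\mathcal{X}_{w_0v[h(i)]}\right).$$ Moreover, the ideal $\tilde{\mathcal{I}}_{\mathsf{s},h}$ defining $\mathcal{Y}_{\mathsf{s},h}$ satisfies $$\tilde{\mathcal{I}}_{\mathsf{s},h}=\mathcal{I}_{\mathsf{s},h}=\bigcap_{i\in\mathcal{C}(h)}\left(\mathcal{L}_{i-1}+\mathcal{K}_{h(i)}\right).$$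
   Context: Let $[n]=\{1,\dots,n\}$, $G=GL_n(\mathbb{C})$, $B\subset G$ the upper triangular and $B_-\subset G$ the lower triangular matrices, $\pi:G\to G/B$ the projection. Let $\mathbf z=\{z_{ij}\}_{1\le i,j\le n}$ be variables, $Z=(z_{ij})$ the generic matrix with columns $v_1,\dots,v_n$, and $M_n(\mathbb{C})=\mathrm{Spec}(\mathbb{C}[\mathbf z])$. Permutations: for $w\in S_n$, $\dot w$ is the permutation matrix with entry $1$ in row $i$, column $j$ iff $w(j)=i$; $w_0$ is the longest element of $S_n$; ''shortest'' means with the fewest inversions. For $k\in[n]$, $u[k]$ is the shortest permutation $u\in S_n$ with $u(k)=1$, and $v[k]$ is the shortest $v\in S_n$ with $v(k)=n$. The matrix Schubert variety is $\mathcal{X}_w=\overline{B\dot wB}\subseteq M_n(\mathbb{C})$ and the opposite matrix Schubert variety is $\mathcal{X}_w^{\mathrm{op}}=\overline{B_-\dot wB}\subseteq M_n(\mathbb{C})$ (Zariski closures, reduced). With $X_w=\overline{B\dot wB/B}$ and $X_w^{\mathrm{op}}=\overline{B_-\dot wB/B}$ in $G/B$, a matrix Richardson variety (scheme) is the closure $\overline{\pi^{-1}(X_u^{\mathrm{op}}\cap X_v)}\subseteq M_n(\mathbb{C})$ with $X_u^{\mathrm{op}}\cap X_v\neq\emptyset$. A Hessenberg function is a map $h:[n]\to[n]$ with $h(i)\ge i$ for all $i$ and $h(i-1)\le h(i)$ for $2\le i\le n$; by convention $h(0)=0$. Its corner set is $\mathcal{C}(h)=\{i\in[n]:h(i)>h(i-1)\}$.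 Ideals: $\mathcal{L}_0=\langle0\rangle$ and $\mathcal{L}_i=\langle z_{11},z_{12},\dots,z_{1i}\rangle$ for $i\in[n-1]$; $\mathcal{K}_n=\langle0\rangle$ and, for $i\in[n-1]$, $\mathcal{K}_i=\langle p_A: A\subseteq\{2,\dots,n\},|A|=i\rangle$ where $p_A=\det(z_{k\ell})_{k\in A,\,1\le\ell\le i}$. For $\mathsf{x}\in\mathfrak{gl}_n(\mathbb{C})$ and $i\in[n]$ with $h(i)<n$, let $\mathcal{I}_{\mathsf{x},h,i}\subseteq\mathbb{C}[\mathbf z]$ be the ideal generated by all $(h(i)+1)\times(h(i)+1)$ minors of the $n\times(i+h(i))$ matrix $[\mathsf{x}v_1\,|\cdots|\,\mathsf{x}v_i\,|\,v_1\,|\cdots|\,v_{h(i)}]$; if $h(i)=n$, $\mathcal{I}_{\mathsf{x},h,i}=0$. Put $\mathcal{I}_{\mathsf{x},h}=\sum_{i\in[n]}\mathcal{I}_{\mathsf{x},h,i}$. Let $d=\det(Z)$ and $\iota:\mathbb{C}[\mathbf z]\hookrightarrow\mathbb{C}[\mathbf z,d^{-1}]$ the localization map. For an ideal $\mathcal{I}\subseteq\mathbb{C}[\mathbf z]$, $\tilde{\mathcal{I}}$ is the preimage under $\iota$ of the ideal generated by $\iota(\mathcal{I})$. The matrix Hessenberg scheme is $\mathcal{Y}_{\mathsf{x},h}=\mathrm{Spec}(\mathbb{C}[\mathbf z]/\tilde{\mathcal{I}}_{\mathsf{x},h})$. ''Reduced union'' means that the scheme is reduced and equals the stated union. *)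

(* Defs.v *)
From mathcomp Require Import all_boot all_order all_fingroup all_algebra.
From mathcomp Require Import classical_sets reals.
From mathcomp Require Import complex mpoly.
Set Implicit Arguments.
Unset Strict Implicit.
Unset Printing Implicit Defensive.
Import GRing.Theory.
Local Open Scope ring_scope.
Local Open Scope classical_set_scope.

(* Throughout, matrices have size n.+1 (so the size is at least 1), and the
   index set {1, ..., n.+1} is 'I_n.+1: the ordinal i stands for the
   mathematical index i.+1. *)

(** Ideals *)

(* The ideal generated by S in the subring A of R. *)
Definition ideal_gen_in (R : comNzRingType) (A S : set R) : set R :=
  [set x | exists s : seq (R * R),
    (forall y, y \in s -> A y.1 /\ S y.2) /\ x = \sum_(y <- s) y.1 * y.2].

Definition ideal_gen (R : comNzRingType) (S : set R) : set R :=
  ideal_gen_in setT S.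

Definition ideal_add (R : comNzRingType) (I J : set R) : set R :=
  [set x | exists a b, [/\ I a, J b & x = a + b]].

Definition ideal_sum (R : comNzRingType) (T : finType) (I : T -> set R) :
    set R :=
  [set x | exists a : T -> R, (forall t, I t (a t)) /\ x = \sum_t a t].

Section MatrixSpace.
Variables (F : fieldType) (n : nat).

(* Polynomials in the entries of an n.+1 x n.+1 matrix; the variable z_ij
   has index mxvec_index i j. *)
Local Notation mxpol := {mpoly F[n.+1 * n.+1]}.

Definition Zmx : 'M[mxpol]_n.+1 := \matrix_(i, j) 'X_(mxvec_index i j).

Definition mxeval (f : mxpol) (A : 'M[F]_n.+1) : F :=
  f.@[fun k => mxvec A 0 k].

Definition zeros (I : set mxpol) : set 'M[F]_n.+1 :=
  [set A | forall f, I f -> mxeval f A = 0].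

Definition vanishing (S : set 'M[F]_n.+1) : set mxpol :=
  [set f | forall A, S A -> mxeval f A = 0].

Definition zclosed (D : set 'M[F]_n.+1) : Prop :=
  exists I : set mxpol, D = zeros I.

Definition zclosure (S : set 'M[F]_n.+1) : set 'M[F]_n.+1 :=
  zeros (vanishing S).

(** Closed subschemes of the space of matrices.
    The closed subscheme Spec (F[z] / I) is represented by its ideal I, so
    that equality of closed subschemes is equality of ideals. *)

(* The quotient F[z] / I has no nonzero nilpotent element. *)
Definition reduced_scheme (I : set mxpol) : Prop :=
  forall f k, I (f ^+ k) -> I f.

Definition scheme_union (T : Type) (P : set T) (I : T -> set mxpol) :
    set mxpol :=
  \bigcap_(t in P) I t.

Definition scheme_inter (I J : set mxpol) : set mxpol := ideal_add I J.

(* A Zariski closed set with its reduced structure. *)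
Definition variety (S : set 'M[F]_n.+1) : set mxpol := vanishing S.

(** Matrix Schubert and matrix Richardson varieties *)

(* Entry 1 in position (i, j) iff w j = i; this is the transpose of
   perm_mx w. *)
Definition permutation_matrix (w : 'S_n.+1) : 'M[F]_n.+1 :=
  \matrix_(i, j) (w j == i)%:R.

Definition borel : set 'M[F]_n.+1 :=
  [set A | A \in unitmx /\ is_trig_mx A^T].

(* is_trig_mx means lower triangular. *)
Definition borel_op : set 'M[F]_n.+1 :=
  [set A | A \in unitmx /\ is_trig_mx A].

Definition double_coset (P Q : set 'M[F]_n.+1) (w : 'S_n.+1) :
    set 'M[F]_n.+1 :=
  [set A | exists a b, [/\ P a, Q b & A = a *m permutation_matrix w *m b]].

Definition matrix_schubert (w : 'S_n.+1) : set 'M[F]_n.+1 :=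
  zclosure (double_coset borel borel w).

Definition matrix_schubert_op (w : 'S_n.+1) : set 'M[F]_n.+1 :=
  zclosure (double_coset borel_op borel w).

(* Points of G/B are the cosets gB with g invertible. *)
Definition coset_borel (g : 'M[F]_n.+1) : set 'M[F]_n.+1 :=
  [set A | exists2 b, borel b & A = g *m b].

(* The Zariski topology of G/B is the quotient of that of G: a set of cosets
   is closed iff its preimage is the trace on G of a closed set of
   matrices. *)
Definition flag_closed (K : set (set 'M[F]_n.+1)) : Prop :=
  K `<=` coset_borel @` [set g | g \in unitmx] /\
  exists2 D, zclosed D &
    forall g, g \in unitmx -> (K (coset_borel g) <-> D g).

Definition flag_closure (S : set (set 'M[F]_n.+1)) : set (set 'M[F]_n.+1) :=
  \bigcap_(K in [set K | flag_closed K /\ S `<=` K]) K.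

Definition schubert (w : 'S_n.+1) : set (set 'M[F]_n.+1) :=
  flag_closure (coset_borel @` double_coset borel borel w).

Definition schubert_op (w : 'S_n.+1) : set (set 'M[F]_n.+1) :=
  flag_closure (coset_borel @` double_coset borel_op borel w).

Definition matrix_richardson (u v : 'S_n.+1) : set 'M[F]_n.+1 :=
  zclosure [set g | g \in unitmx /\
                    (schubert_op u `&` schubert v) (coset_borel g)].

Definition is_matrix_richardson_scheme (I : set mxpol) : Prop :=
  exists u v, schubert_op u `&` schubert v !=set0 /\
              I = variety (matrix_richardson u v).

(** The ideals L_k and K_k *)

(* Generated by the first k entries of the first row. *)
Definition L_ideal (k : nat) : set mxpol :=
  ideal_gen [set f | exists2 j : 'I_n.+1, (j < k)%N & f = Zmx ord0 j].

(* Rows A (in increasing order), columns 1, ..., #|A|; the cast inord is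
   harmless since #|A| <= n.+1. *)
Definition p_minor (A : {set 'I_n.+1}) : mxpol :=
  \det (\matrix_(a < #|A|, b < #|A|) Zmx (enum_val a) (inord b)).

(* For k = n.+1 there is no such A and this is the zero ideal. *)
Definition K_ideal (k : nat) : set mxpol :=
  ideal_gen [set f | exists A : {set 'I_n.+1},
                       [/\ ord0 \notin A, #|A| = k & f = p_minor A]].

(** Matrix Hessenberg schemes *)

Definition is_minor (R : comNzRingType) (k p q : nat) (M : 'M[R]_(p, q))
    (x : R) : Prop :=
  exists (r : 'I_k -> 'I_p) (c : 'I_k -> 'I_q),
    [/\ {homo r : a b / (a < b)%N}, {homo c : a b / (a < b)%N}
      & x = \det (mxsub r c M)].

(* Columns of index at most i, that is, the first i.+1 columns. *)
Definition first_cols (R : Type) (M : 'M[R]_n.+1) (i : 'I_n.+1) :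
    'M[R]_(n.+1, i.+1) :=
  colsub (widen_ord (ltn_ord i)) M.

(* When h i is the last index there is no minor of this size and this is the
   zero ideal. *)
Definition hess_ideal_at (x : 'M[F]_n.+1) (h : 'I_n.+1 -> 'I_n.+1)
    (i : 'I_n.+1) : set mxpol :=
  ideal_gen
    [set f | is_minor (h i).+2
               (row_mx (first_cols (map_mx (fun c => c%:MP) x *m Zmx) i)
                       (first_cols Zmx (h i))) f].

Definition hess_ideal (x : 'M[F]_n.+1) (h : 'I_n.+1 -> 'I_n.+1) : set mxpol :=
  ideal_sum (hess_ideal_at x h).

(* F[z, 1/d] with d = \det Z, as a subring of the fraction field of F[z]. *)
Definition localized : set {fraction mxpol} :=
  [set y | exists a k, y = tofrac a / tofrac (\det Zmx) ^+ k].

Definition saturation (I : set mxpol) : set mxpol :=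
  [set f | ideal_gen_in localized (@tofrac mxpol @` I) (tofrac f)].

Definition matrix_hessenberg_scheme (x : 'M[F]_n.+1)
    (h : 'I_n.+1 -> 'I_n.+1) : set mxpol :=
  saturation (hess_ideal x h).

(* diag(1, 0, ..., 0) *)
Definition s_mx : 'M[F]_n.+1 := delta_mx ord0 ord0.

End MatrixSpace.

(** Permutations and Hessenberg functions *)

Section Combinatorics.
Variable n : nat.

Definition inversions (w : 'S_n.+1) : nat :=
  #|[set p : 'I_n.+1 * 'I_n.+1 | (p.1 < p.2)%N && (w p.2 < w p.1)%N]%SET|.

Definition u_short (k : 'I_n.+1) : 'S_n.+1 :=
  [arg min_(u < tperm k ord0 | u k == ord0) inversions u].

Definition v_short (k : 'I_n.+1) : 'S_n.+1 :=
  [arg min_(v < tperm k ord_max | v k == ord_max) inversions v].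

Definition w0 : 'S_n.+1 := perm (@rev_ord_inj n.+1).

Definition hessenberg (h : 'I_n.+1 -> 'I_n.+1) : Prop :=
  (forall i : 'I_n.+1, (i <= h i)%N) /\
  (forall i j : 'I_n.+1, j = i.+1 :> nat -> (h i <= h j)%N).

(* The first index is always a corner, by the convention h(0) = 0. *)
Definition corner (h : 'I_n.+1 -> 'I_n.+1) : set 'I_n.+1 :=
  [set i : 'I_n.+1 | forall j : 'I_n.+1, i = j.+1 :> nat -> (h j < h i)%N].

End Combinatorics.

Arguments s_mx F n : clear implicits.

(* Main.v *)
(* For s = diag(1, 0, ..., 0) a minor of [s v_1 | ... | s v_i | v_1 | ... | v_h(i)]
   of size h(i) + 1 is zero or of the form z_1j p_A, so I_{s,h} is the sum of the
   products L_i K_h(i).  The L_i increase, the K_h(i) decrease, and L :&: K = L K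
   because their generators involve disjoint sets of variables; hence the sum of
   the products is the intersection of the ideals L_(i-1) + K_h(i).

   The geometric part rests on the fact that the ideal K_k of maximal minors
   contains every polynomial vanishing on its zero locus.  This is proved with a
   principal radical system (Hochster-Eagon): adjoin to the minors the entries of
   one row one after the other, and descend by induction on the degree.  All other
   density statements follow by joining a given point to a permutation matrix by a
   polynomial curve inside the locus in question.  A matrix all of whose leading
   minors (after a permutation w of the rows) are nonzero is then put into the cell
   of w by Gaussian elimination.  Finally, L_(i-1) + K_h(i) is the vanishing ideal of
   a set of invertible matrices, which gives reducedness and saturation. *)

Require Import Defs.
From mathcomp Require Import all_boot all_order all_fingroup all_algebra.
From mathcomp Require Import boolp classical_sets reals.
From mathcomp Require Import complex mpoly.
From HB Require Import structures.
From mathcomp Require Import zify.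
Set Implicit Arguments.
Unset Strict Implicit.
Unset Printing Implicit Defensive.
Import Order.TTheory GRing.Theory Num.Theory.
Local Open Scope ring_scope.
Local Open Scope classical_set_scope.

(** * Ideals and polynomials *)

Section Ideals.
Variable R : comNzRingType.
Implicit Types (I J S : set R) (a b x : R).

Definition is_ideal I :=
  [/\ I 0, forall a b, I a -> I b -> I (a + b) & forall a b, I b -> I (a * b)].

Lemma is_ideal_sum I (T : Type) (s : seq T) (P : pred T) (f : T -> R) :
  is_ideal I -> (forall t, P t -> I (f t)) -> I (\sum_(t <- s | P t) f t).
Proof. by case=> I0 ID _ If; elim/big_ind: _. Qed.

Lemma is_idealB I a b : is_ideal I -> I a -> I b -> I (a - b).
Proof. by case=> _ ID IM Ia Ib; apply: ID => //; rewrite -mulN1r; apply: IM. Qed.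

Lemma ideal_gen_ideal S : is_ideal (ideal_gen S).
Proof.
split.
- by exists [::]; rewrite big_nil.
- move=> _ _ [s [Ss ->]] [t [St ->]]; exists (s ++ t); rewrite big_cat; split=> //.
  by move=> y; rewrite mem_cat => /orP [/Ss|/St].
- move=> a _ [s [Ss ->]]; exists [seq (a * y.1, y.2) | y <- s]; split.
    by move=> _ /mapP [y /Ss [_ Sy] ->].
  by rewrite big_map mulr_sumr; apply: eq_bigr => y _; rewrite mulrA.
Qed.

Lemma ideal_gen_sub S : S `<=` ideal_gen S.
Proof.
move=> x Sx; exists [:: (1, x)]; rewrite big_seq1 mul1r; split=> //.
by move=> y; rewrite inE => /eqP ->.
Qed.

Lemma ideal_gen_min S I : is_ideal I -> S `<=` I -> ideal_gen S `<=` I.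
Proof.
move=> [I0 ID IM] SI _ [s [Ss ->]]; rewrite big_seq.
by apply: (big_ind I) => // y /Ss [_ /SI]; apply: IM.
Qed.

Lemma ideal_add_ideal I J : is_ideal I -> is_ideal J -> is_ideal (ideal_add I J).
Proof.
move=> [I0 ID IM] [J0 JD JM]; split.
- by exists 0, 0; rewrite addr0.
- move=> _ _ [a [b [Ia Jb ->]]] [a' [b' [Ia' Jb' ->]]].
  by exists (a + a'), (b + b'); rewrite addrACA; split; [exact: ID|exact: JD|].
- move=> c _ [a [b [Ia Jb ->]]].
  by exists (c * a), (c * b); rewrite mulrDr; split; [exact: IM|exact: JM|].
Qed.

Lemma ideal_add_subl I J : is_ideal J -> I `<=` ideal_add I J.
Proof. by move=> [J0 _ _] x Ix; exists x, 0; rewrite addr0. Qed.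

Lemma ideal_add_subr I J : is_ideal I -> J `<=` ideal_add I J.
Proof. by move=> [I0 _ _] x Jx; exists 0, x; rewrite add0r. Qed.

Lemma ideal_add_min I J K :
  is_ideal K -> I `<=` K -> J `<=` K -> ideal_add I J `<=` K.
Proof. by move=> [_ KD _] IK JK _ [a [b [/IK Ka /JK Kb ->]]]; apply: KD. Qed.

Lemma ideal_addS I J I' J' :
  I `<=` I' -> J `<=` J' -> ideal_add I J `<=` ideal_add I' J'.
Proof. by move=> II' JJ' _ [a [b [/II' Ia /JJ' Jb ->]]]; exists a, b. Qed.

Lemma ideal_sum_ideal (T : finType) (I : T -> set R) :
  (forall t, is_ideal (I t)) -> is_ideal (ideal_sum I).
Proof.
move=> idI; split.
- by exists (fun=> 0); rewrite big1_eq; split=> // t; case: (idI t).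
- move=> _ _ [a [Ia ->]] [b [Ib ->]]; exists (fun t => a t + b t).
  by rewrite big_split; split=> // t; case: (idI t) => _ + _; apply.
- move=> c _ [a [Ia ->]]; exists (fun t => c * a t).
  by rewrite mulr_sumr; split=> // t; case: (idI t) => _ _; apply.
Qed.

Lemma ideal_sum_sub (T : finType) (I : T -> set R) t :
  (forall t, is_ideal (I t)) -> I t `<=` ideal_sum I.
Proof.
move=> idI x Ix; exists (fun u => if u == t then x else 0); split.
  by move=> u; case: eqP => [->|] //; case: (idI u).
by rewrite (bigD1 t) //= eqxx big1 ?addr0 // => u /negbTE ->.
Qed.

Lemma ideal_sum_min (T : finType) (I : T -> set R) J :
  is_ideal J -> (forall t, I t `<=` J) -> ideal_sum I `<=` J.
Proof.
by move=> idJ IJ _ [a [Ia ->]]; apply: is_ideal_sum => // t _; apply: IJ.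
Qed.

End Ideals.

(** * Degree-bounded spans, setting variables to zero, polynomial curves *)

Section Polynomials.
Variables (F : numFieldType) (p : nat).
Local Notation mpol := {mpoly F[p]}.
Implicit Types (f g a b : mpol) (G : nat -> set mpol) (S : pred 'I_p).

(* The ideal generated by the elements of the G d, with a degree bound: an
   element g of G d counts as having degree d, and a combination of such
   generators must have terms of msize at most D. *)
Inductive fspan G D : set mpol :=
| Fspan0 : fspan G D 0
| FspanD d a g f : G d g -> (msize a + d <= D)%N -> fspan G D f ->
    fspan G D (a * g + f).

Lemma fspan_gen G D d a g : G d g -> (msize a + d <= D)%N -> fspan G D (a * g).
Proof.
by move=> Gg leD; rewrite -[a * g]addr0; apply: FspanD Gg leD (Fspan0 _ _).
Qed.

Lemma fspan_add G D f g : fspan G D f -> fspan G D g -> fspan G D (f + g).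
Proof.
move=> sf sg; elim: sf => [|d a h f' Gh leD _ IH]; first by rewrite add0r.
by rewrite -addrA; apply: FspanD Gh leD IH.
Qed.

Lemma fspan_sum G D (T : Type) (s : seq T) (P : pred T) (f : T -> mpol) :
  (forall t, P t -> fspan G D (f t)) -> fspan G D (\sum_(t <- s | P t) f t).
Proof. by move=> sf; elim/big_ind: _ => //; [exact: Fspan0|exact: fspan_add]. Qed.

Lemma fspan_subM G G' D D' x f :
  (forall d a g, G d g -> (msize a + d <= D)%N -> fspan G' D' (x * (a * g))) ->
  fspan G D f -> fspan G' D' (x * f).
Proof.
move=> GG'; elim=> [|d a g f' Gg leD _ IH]; first by rewrite mulr0; apply: Fspan0.
by rewrite mulrDr; apply: fspan_add => //; apply: GG' Gg leD.
Qed.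

Lemma fspan_sub G G' D D' f :
  (forall d a g, G d g -> (msize a + d <= D)%N -> fspan G' D' (a * g)) ->
  fspan G D f -> fspan G' D' f.
Proof.
move=> GG'; elim=> [|d a g f' Gg leD _ IH]; first exact: Fspan0.
by apply: fspan_add => //; apply: GG' Gg leD.
Qed.

Lemma fspan_incl G G' D D' f :
  (D <= D')%N -> (forall d g, G d g -> G' d g) -> fspan G D f -> fspan G' D' f.
Proof.
move=> leD GG'; apply: fspan_sub => d a g /GG' Gg le.
by apply: fspan_gen Gg (leq_trans le leD).
Qed.

(** [msize] is the degree plus one, and 0 for the zero polynomial, so a factor of degree at most [d]
    adds at most [d]. *)
Lemma msizeM_leS a b d : (msize b <= d.+1)%N -> (msize (a * b) <= msize a + d)%N.
Proof.
move=> le; have [->|a0] := eqVneq a 0; first by rewrite mul0r msize0.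
have [->|b0] := eqVneq b 0; first by rewrite mulr0 msize0.
by rewrite msizeM // -ltnS prednK ?addn_gt0 ?lt0n ?msize_poly_eq0 ?a0 // -addnS leq_add2l.
Qed.

Lemma fspan_mul G D d f b :
  (msize b <= d.+1)%N -> fspan G D f -> fspan G (D + d) (b * f).
Proof.
move=> leb; elim=> [|e a g f' Gg leD _ IH]; first by rewrite mulr0; apply: Fspan0.
rewrite mulrDr; apply: fspan_add => //; rewrite mulrA; apply: fspan_gen Gg _.
by rewrite mulrC (leq_trans (leq_add (msizeM_leS _ leb) (leqnn e))) // addnAC leq_add2r.
Qed.

Lemma fspan_ideal G D f I : is_ideal I -> (forall d g, G d g -> I g) ->
  fspan G D f -> I f.
Proof.
move=> [I0 ID IM] GI; elim=> // d a g f' Gg _ _ If'.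
by apply: (ID) If'; apply: IM; apply: GI Gg.
Qed.

(** Collects the terms in the generator [x] of degree 1; its coefficient obeys the smaller bound
    [D.-1], which drives the later induction on the degree. *)
Lemma fspan_split G G' D x f :
  (forall d g, G' d g -> G d g \/ d = 1%N /\ g = x) -> fspan G' D f ->
  exists b j, [/\ f = j + b * x, fspan G D j & (msize b <= D.-1)%N].
Proof.
move=> GG'; elim=> [|d a g f' Gg leD _ [b [j [-> sj leb]]]].
  by exists 0, 0; rewrite mul0r addr0 msize0; split=> //; apply: Fspan0.
have [Gg'|[d1 ->]] := GG' _ _ Gg.
  exists b, (a * g + j); rewrite addrA; split=> //.
  by apply: fspan_add => //; apply: fspan_gen Gg' leD.
exists (a + b), j; rewrite mulrDl addrCA; split=> //.
apply: leq_trans (msizeD_le _ _) _; rewrite geq_max leb andbT.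
by move: leD; rewrite d1 addn1; case: (D).
Qed.

(** The retraction onto the polynomials free of the variables in [S]; its kernel is the ideal these
    variables generate. *)
Definition kill S f : mpol :=
  mmap (@mpolyC p F) (fun i => if S i then 0 else 'X_i) f.

HB.instance Definition _ S := GRing.RMorphism.copy (kill S)
  (mmap (@mpolyC p F) (fun i => if S i then 0 else 'X_i)).

Lemma killX S i : kill S 'X_i = if S i then 0 else 'X_i.
Proof. by rewrite /kill mmapX mmap1U. Qed.

Definition vars S : nat -> set mpol :=
  fun d g => d = 1%N /\ exists2 i, S i & g = 'X_i.

Lemma kill_monom S m :
  kill S 'X_[m] = 'X_[m] \/
  kill S 'X_[m] = 0 /\ exists i m', S i /\ m = (m' + U_(i))%MM.
Proof.
rewrite /kill mmapX /mmap1.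
have [/existsP [i /andP [Si mi]]|/existsPn noS] := boolP [exists i, S i && (m i != 0)%N].
  right; split; first by rewrite (bigD1 i) //= Si expr0n (negbTE mi) mul0r.
  exists i, (m - U_(i))%MM; rewrite submK //; apply/mnm_lepP => j.
  by rewrite mnm1E; case: eqP => // <-; rewrite lt0n.
left; rewrite (mpolyXE_id _ m). apply: eq_bigr => i _.
have := noS i; rewrite negb_and negbK; case: (S i) => //= /eqP ->.
by rewrite !expr0.
Qed.

Lemma kill_sum S f :
  kill S f = \sum_(m <- msupp f) f@_m *: kill S 'X_[m].
Proof.
rewrite {1}(mpolyE f) raddf_sum; apply: eq_bigr => m _.
by rewrite /= {1}/kill mmapZ mul_mpolyC.
Qed.

Lemma meval_kill S f v :
  (kill S f).@[v] = f.@[fun i => if S i then 0 else v i].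
Proof.
rewrite kill_sum raddf_sum mevalE; apply: eq_bigr => m _ /=.
rewrite mevalZ /kill mmapX /mmap1 rmorph_prod; congr (_ * _).
apply: eq_bigr => i _; rewrite rmorphXn /=.
by case: ifP; rewrite ?meval0 ?mevalXU.
Qed.

Lemma msizeZX_lt (c : F) m D : (mdeg m < D)%N -> (msize (c *: 'X_[m] : mpol) <= D)%N.
Proof. by move=> lt; apply: leq_trans (msizeZ_le _ _) _; rewrite msizeX. Qed.

Lemma msize_kill S f : (msize (kill S f) <= msize f)%N.
Proof.
rewrite kill_sum big_seq; elim/big_ind: _ => [|a b la lb|m /msize_mdeg_lt lt].
- by rewrite msize0.
- by apply: leq_trans (msizeD_le _ _) _; rewrite geq_max la lb.
have [->|[-> _]] := kill_monom S m; last by rewrite scaler0 msize0.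
exact: msizeZX_lt.
Qed.

(** A killed monomial is a variable in [S] times a monomial of degree one less, so the degree bound
    is kept. *)
Lemma kill_split S D f : (msize f <= D)%N -> fspan (vars S) D (f - kill S f).
Proof.
move=> leD; rewrite {1}(mpolyE f) kill_sum -sumrB big_seq.
apply: fspan_sum => m /msize_mdeg_lt lt.
have [->|[-> [i [m' [Si em]]]]] := kill_monom S m.
  by rewrite subrr; apply: Fspan0.
rewrite scaler0 subr0 em mpolyXD scalerAl; apply: (fspan_gen (d := 1)).
  by split=> //; exists i.
rewrite addn1; apply: leq_trans leD; apply: leq_ltn_trans (msizeZX_lt _ (leqnn _)) _.
by move: lt; rewrite em mdegD mdeg1 addn1.
Qed.

Definition mcurve (C : 'I_p -> {poly F}) f : {poly F} := mmap polyC C f.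

Lemma horner_mcurve C f e : (mcurve C f).[e] = f.@[fun i => (C i).[e]].
Proof.
rewrite {1}(mpolyE f) /mcurve raddf_sum /= mevalE horner_sum.
apply: eq_bigr => m _; rewrite mmapZ mmapX /= hornerM hornerC /mmap1.
by rewrite horner_prod; congr (_ * _); apply: eq_bigr => i _; rewrite horner_exp.
Qed.

(** In characteristic 0 the naturals supply [size q] distinct roots, one more than the degree
    allows. *)
Lemma poly_vanish (q : {poly F}) : (forall e, q.[e] = 0) -> q = 0.
Proof.
move=> q0; apply/eqP/contraT => nz.
have := max_poly_roots nz (rs := [seq i%:R | i <- iota 0 (size q)]).
rewrite size_map size_iota ltnn; apply.
  by apply/allP => x _; apply/rootP.
rewrite map_inj_in_uniq ?iota_uniq // => i j _ _ /eqP.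
by rewrite eqr_nat => /eqP.
Qed.

(* A polynomial curve that lies generically in a set lies in its Zariski
   closure. *)
Lemma curve_vanish (C : 'I_p -> {poly F}) (g : {poly F}) f :
  g != 0 -> (forall e, g.[e] != 0 -> f.@[fun i => (C i).[e]] = 0) ->
  forall e, f.@[fun i => (C i).[e]] = 0.
Proof.
move=> nz Cf e; rewrite -horner_mcurve.
(* The product vanishes at every point, hence is the zero polynomial, and [g] can be cancelled. *)
suff /eqP : mcurve C f * g = 0.
  by rewrite mulf_eq0 (negbTE nz) orbF => /eqP ->; rewrite horner0.
apply: poly_vanish => x; rewrite hornerM; have [->|/Cf] := eqVneq g.[x] 0.
  by rewrite mulr0.
by rewrite horner_mcurve => ->; rewrite mul0r.
Qed.

Lemma eq_kill S S' f : S =1 S' -> kill S f = kill S' f.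
Proof.
move=> eS; rewrite !kill_sum; apply: eq_bigr => m _; rewrite /kill !mmapX.
by congr (_ *: _); apply: mmap1_eq => i; rewrite eS.
Qed.

Lemma kill_kill S S' f : kill S (kill S' f) = kill (predU S S') f.
Proof.
rewrite [kill S' f]kill_sum [RHS]kill_sum raddf_sum; apply: eq_bigr => m _ /=.
rewrite {1}/kill mmapZ mul_mpolyC; congr (_ *: _).
rewrite [kill S' _]/kill [RHS]/kill !mmapX /mmap1 rmorph_prod.
apply: eq_bigr => i _; rewrite rmorphXn /=; congr (_ ^+ _).
by case: (S' i); rewrite ?orbT ?orbF -/(kill _ _) ?rmorph0 ?killX.
Qed.

Lemma kill_all f : kill predT f = (f.@[fun=> 0])%:MP.
Proof.
rewrite kill_sum mevalE raddf_sum; apply: eq_bigr => m _ /=.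
rewrite /kill mmapX mpolyCM mul_mpolyC; congr (_ *: _).
rewrite /mmap1 (rmorph_prod (@mpolyC p F)); apply: eq_bigr => i _.
by rewrite rmorphXn /= mpolyC0.
Qed.

Lemma kill0 f : kill pred0 f = f.
Proof.
rewrite kill_sum [RHS]mpolyE; apply: eq_bigr => m _; congr (_ *: _).
by case: (kill_monom pred0 m) => // -[_ [i [m' []]]].
Qed.

(** Subtracting from [f] its part without X_i leaves X_i times a smaller [b], which vanishes where
    X_i does not, hence everywhere, hence is 0 by induction. So [f] involves no variable and equals
    its value at the origin. *)
Lemma mpoly_vanish f : (forall v, f.@[v] = 0) -> f = 0.
Proof.
move: {2}(msize f) (leqnn (msize f)) => D.
elim: D f => [|D IH] f leD f0.
  by apply/eqP; rewrite -msize_poly_eq0 -leqn0.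
have killK i : kill (pred1 i) f = f.
  apply/esym/eqP; rewrite -subr_eq0.
  have [|b [j [eb sj leb]]] := fspan_split (G := fun=> set0) (x := 'X_i) _
    (kill_split (pred1 i) leD).
    by move=> d g [-> [k /eqP -> ->]]; right.
  have j0 : j = 0 by elim: sj => // d a g f' [].
  move: eb; rewrite {}j0 add0r {sj} => eb; rewrite eb (IH b) ?mul0r //.
  move=> v; pose C k := if k == i then 'X + (v i)%:P else (v k)%:P.
  have Cv k : (C k).[0] = v k.
    by rewrite /C; case: eqP => [->|]; rewrite ?hornerE.
  rewrite -(meval_eq b Cv); apply: (@curve_vanish _ (C i)).
    by rewrite /C eqxx -size_poly_eq0 size_XaddC.
  move=> e nz; apply: (mulIf nz); rewrite mul0r.
  rewrite -(mevalXU (fun k => (C k).[e]) i) -mevalM -eb mevalB meval_kill !f0.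
  by rewrite subr0.
have -> : f = kill predT f.
  have <- : kill (mem (enum 'I_p)) f = kill predT f.
    by apply: eq_kill => i; rewrite /= mem_enum.
  elim: (enum 'I_p) => [|i s IHs]; first by rewrite kill0.
  by rewrite {1}IHs -{1}(killK i) kill_kill; apply: eq_kill => k; rewrite /= !inE orbC.
by rewrite kill_all f0 mpolyC0.
Qed.

End Polynomials.

(** * Ideals of maximal minors *)

Section MatrixPolynomials.
Variables (F : numFieldType) (n : nat).
Local Notation N := n.+1.
Local Notation mxpol := {mpoly F[N * N]}.
Implicit Types (f g : mxpol) (A B : 'M[F]_N) (T : 'I_N -> 'I_N -> bool).
Local Notation Z := (Zmx F n).

Lemma mxeval_Z A i j : mxeval (Z i j) A = A i j.
Proof. by rewrite /mxeval mxE mevalXU mxvecE. Qed.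

Lemma mxeval_det A k (r c : 'I_k -> 'I_N) :
  mxeval (\det (mxsub r c Z)) A = \det (mxsub r c A).
Proof.
rewrite /mxeval -det_map_mx; congr (\det _); apply/matrixP => i j.
by rewrite 2!mxE [RHS]mxE -mxeval_Z.
Qed.

Lemma mxeval_detZ A : mxeval (\det Z) A = \det A.
Proof.
rewrite /mxeval -det_map_mx; congr (\det _); apply/matrixP => r c.
by rewrite mxE -mxeval_Z.
Qed.

Definition zeroing T A : 'M[F]_N := \matrix_(i, j) if T i j then 0 else A i j.

Definition mxpred T : pred 'I_(N * N) :=
  fun k => mxvec (\matrix_(i, j) T i j) 0 k.

Lemma mxpredE T i j : mxpred T (mxvec_index i j) = T i j.
Proof. by rewrite /mxpred mxvecE mxE. Qed.

Lemma mxeval_kill T f A : mxeval (kill (mxpred T) f) A = mxeval f (zeroing T A).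
Proof.
rewrite /mxeval meval_kill; apply: meval_eq => k.
by case/mxvec_indexP: k => i j; rewrite mxpredE !mxvecE mxE.
Qed.

Lemma kill_Z T i j : kill (mxpred T) (Z i j) = if T i j then 0 else Z i j.
Proof. by rewrite mxE killX mxpredE. Qed.

Lemma kill_det T k (r c : 'I_k -> 'I_N) : (forall a b, ~~ T (r a) (c b)) ->
  kill (mxpred T) (\det (mxsub r c Z)) = \det (mxsub r c Z).
Proof.
move=> nT; rewrite -det_map_mx; congr (\det _); apply/matrixP => i j.
transitivity (kill (mxpred T) (Z (r i) (c j))); first by rewrite !mxE.
by rewrite kill_Z (negbTE (nT _ _)) [RHS]mxE.
Qed.

Definition entries T : nat -> set mxpol :=
  fun d g => d = 1%N /\ exists i j, T i j /\ g = Z i j.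

Lemma kill_entries T D f : (msize f <= D)%N ->
  fspan (entries T) D (f - kill (mxpred T) f).
Proof.
move/(kill_split (mxpred T)); apply: fspan_incl => // d g [-> [k Tk ->]].
split=> //; case/mxvec_indexP: k Tk => i j; rewrite mxpredE => Tij.
by exists i, j; rewrite mxE.
Qed.

Lemma mx_vanish f : (forall A, mxeval f A = 0) -> f = 0.
Proof.
move=> f0; apply: mpoly_vanish => v.
rewrite -(f0 (vec_mx (\row_k v k))); apply: meval_eq => k.
by rewrite vec_mxK mxE.
Qed.

Lemma mxcurve_vanish (C : 'M[{poly F}]_N) (g : {poly F}) f :
  g != 0 -> (forall e, g.[e] != 0 -> mxeval f (map_mx (horner^~ e) C) = 0) ->
  forall e, mxeval f (map_mx (horner^~ e) C) = 0.
Proof.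
have eC e : mxeval f (map_mx (horner^~ e) C) = f.@[fun k => (mxvec C 0 k).[e]].
  by apply: meval_eq; case/mxvec_indexP => i j; rewrite !mxvecE mxE.
move=> nz Cf e; rewrite eC; apply: (curve_vanish nz) => x /Cf.
by rewrite eC.
Qed.

(** Restricted to the curve, [g] is a polynomial in one variable, nonzero because of its value at
    [e0]. *)
Lemma mxcurve_dense (C : 'M[{poly F}]_N) g f e0 :
  mxeval g (map_mx (horner^~ e0) C) != 0 ->
  (forall e, mxeval g (map_mx (horner^~ e) C) != 0 ->
     mxeval f (map_mx (horner^~ e) C) = 0) ->
  forall e, mxeval f (map_mx (horner^~ e) C) = 0.
Proof.
pose G := mcurve (fun k => mxvec C 0 k) g.
have GE e : G.[e] = mxeval g (map_mx (horner^~ e) C).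
  rewrite horner_mcurve; apply: meval_eq; case/mxvec_indexP => i j.
  by rewrite !mxvecE mxE.
move=> g0 Cf; apply: (@mxcurve_vanish C G) => [|e]; last by rewrite GE; apply: Cf.
by apply: contraNneq g0 => G0; rewrite -GE G0 horner0.
Qed.

Lemma line_vanish A B (g : {poly F}) f :
  g != 0 -> (forall e, g.[e] != 0 -> mxeval f (A + e *: B) = 0) ->
  mxeval f A = 0.
Proof.
move=> nz ABf; pose C := map_mx polyC A + 'X *: map_mx polyC B.
have eC e : map_mx (horner^~ e) C = A + e *: B.
  by apply/matrixP => i j; rewrite !mxE !hornerE.
have -> : A = map_mx (horner^~ 0) C by rewrite eC scale0r addr0.
by apply: (mxcurve_vanish nz) => e /ABf; rewrite eC.
Qed.

Lemma msize_det_le k (M : 'M[mxpol]_k) :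
  (forall i j, (msize (M i j) <= 2)%N) -> (msize (\det M) <= k.+1)%N.
Proof.
move=> leM; rewrite /determinant; elim/big_ind: _ => [|a b la lb|s _].
- by rewrite msize0.
- by apply: leq_trans (msizeD_le _ _) _; rewrite geq_max la lb.
rewrite mulr_sign fun_if msizeN if_same.
pose m i := M i (s i); rewrite -[\prod_i _]/(\prod_i m i).
have : forall i, (msize (m i) <= 2)%N by rewrite /m.
move: m => m {leM M s}.
elim: k m => [|k IH] m lem; first by rewrite big_ord0 msize1.
rewrite big_ord_recr; apply: leq_trans (msizeM_leS _ (lem _)) _.
by rewrite addn1 ltnS; apply: IH.
Qed.

Lemma msize_Z i j : msize (Z i j) = 2%N.
Proof. by rewrite mxE msizeX mdeg1. Qed.

Lemma msize_cofactor k (r c : 'I_k.+1 -> 'I_N) i j :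
  (msize (cofactor (mxsub r c Z) i j) <= k.+1)%N.
Proof.
rewrite /cofactor -signr_odd mulr_sign fun_if msizeN if_same.
by apply: msize_det_le => a b; rewrite 3!mxE msize_Z.
Qed.

(* The generators of the principal radical system, labelled by their degrees. *)
Definition rad_gens r k t : nat -> set mxpol := fun d g =>
  d = k /\ (exists rho : 'I_k -> 'I_N,
     (forall a, (r <= rho a)%N) /\ g = \det (mxsub rho (fun b => inord b) Z)) \/
  entries (fun i j => (i == r :> nat) && (j < t)%N) d g.

(** The first [k] columns, cut down to the rows from [r] on, are linearly dependent. The relation is
    an explicit vector so that it can be deformed along with the matrix; for [k = 0] there is
    none. *)
Definition dependent r k A := exists2 x : 'cV[F]_N, x != 0 &
  (forall j : 'I_N, (k <= j)%N -> x j 0 = 0) /\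
  (forall i : 'I_N, (r <= i)%N -> (A *m x) i 0 = 0).

Definition rad_locus r k t A := dependent r k A /\
  forall i j : 'I_N, i = r :> nat -> (j < t)%N -> A i j = 0.

(** Adding e to coordinate [l] of the relation adds e times column [l] to the product. As [x t 0] is
    nonzero, a multiple of that column subtracted from column [t] cancels it, and column [t] does
    not meet the new coordinate. *)
Lemma kernel_shift r A (x : 'cV[F]_N) (t l : 'I_N) :
  x t 0 != 0 -> x l 0 = 0 ->
  (forall i : 'I_N, (r <= i)%N -> (A *m x) i 0 = 0) ->
  exists B, (forall i j : 'I_N, (i < r)%N || (j != t) -> B i j = 0) /\
    forall e (i : 'I_N), (r <= i)%N ->
      ((A + e *: B) *m (x + e *: delta_mx l 0)) i 0 = 0.
Proof.
move=> xt xl Ax.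
have tl : (l == t) = false by apply: contraNF xt => /eqP <-; rewrite xl.
exists (\matrix_(i, j)
  if j == t then if (r <= i)%N then - (A i l / x t 0) else 0 else 0).
split=> [i j|e i ri].
  by rewrite mxE => /orP [ir|/negbTE -> //]; rewrite leqNgt ir if_same.
set B := \matrix_(_, _) _; rewrite mulmxDl !mulmxDr mxE [_ i 0]mxE Ax // add0r.
rewrite -scalemxAr -scalemxAl -colE [X in X + _]mxE [col l A _ _]mxE.
rewrite [X in _ + X]mxE -[(e *: B) *m _]scalemxAl -scalemxAr -colE.
rewrite !mxE tl !mulr0 addr0 (bigD1 t) //= big1 ?addr0.
  by rewrite mxE eqxx ri mulNr divfK // -mulrDr subrr mulr0.
by move=> j /negbTE jt; rewrite mxE jt mul0r.
Qed.

(** If [x t 0 = 0], the entry (r, t) moves freely. If [x l 0] is nonzero for some l > t, moving it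
    is compensated at (r, l), which respects the zeros before column [t]. Otherwise [kernel_shift]
    first makes coordinate k - 1 of the relation nonzero; it lies beyond [t] because t + 1 < k. *)
Lemma rad_locus_dense (r : 'I_N) k (t : 'I_N) f : (t.+1 < k <= N)%N ->
  (forall A, rad_locus r k t A -> A r t != 0 -> mxeval f A = 0) ->
  forall A, rad_locus r k t A -> mxeval f A = 0.
Proof.
move=> /andP [ltk leN] f0.
have nzX (c : F) : 'X + c%:P != 0 by rewrite -size_poly_eq0 size_XaddC.
have zero_case A (x : 'cV[F]_N) : x != 0 -> (forall j : 'I_N, (k <= j)%N -> x j 0 = 0) ->
    (forall i : 'I_N, (r <= i)%N -> (A *m x) i 0 = 0) ->
    (forall i j : 'I_N, i = r :> nat -> (j < t)%N -> A i j = 0) ->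
    x t 0 = 0 -> mxeval f A = 0.
  move=> x0 xk Ax At xt; apply: (line_vanish (B := delta_mx r t) (nzX (A r t))) => e.
  rewrite !hornerE addrC => nz; apply: f0; last by rewrite !mxE !eqxx mulr1.
  split=> [|i j ir jt].
    exists x => //; split=> // i ri; rewrite mulmxDl mxE Ax // add0r.
    rewrite -scalemxAl mxE [_ i 0]mxE (bigD1 t) //= xt mulr0 add0r big1 ?mulr0 //.
    by move=> j /negbTE jt; rewrite mxE jt andbF mul0r.
  rewrite !mxE At // add0r -(val_eqE j t) /= (ltn_eqF jt) andbF mulr0 //.
have tail_case A (x : 'cV[F]_N) (l : 'I_N) : x != 0 ->
    (forall j : 'I_N, (k <= j)%N -> x j 0 = 0) ->
    (forall i : 'I_N, (r <= i)%N -> (A *m x) i 0 = 0) ->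
    (forall i j : 'I_N, i = r :> nat -> (j < t)%N -> A i j = 0) ->
    (t < l)%N -> x l 0 != 0 -> mxeval f A = 0.
  move=> x0 xk Ax At tl xl.
  pose B : 'M[F]_N := \matrix_(i, j)
    if i == r then if j == t then 1 else if j == l then - (x t 0 / x l 0) else 0
    else 0.
  have tl' : (l == t) = false by rewrite -val_eqE /= gtn_eqF.
  apply: (line_vanish (B := B) (nzX (A r t))) => e.
  rewrite !hornerE addrC => nz; apply: f0; last by rewrite !mxE !eqxx mulr1.
  split=> [|i j ir jt].
    exists x => //; split=> // i ri; rewrite mulmxDl mxE Ax // add0r.
    rewrite -scalemxAl mxE [_ i 0]mxE; have [ir|nir] := eqVneq i r; last first.
      by rewrite big1 ?mulr0 // => j _; rewrite mxE (negbTE nir) mul0r.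
    rewrite (bigD1 t) //= (bigD1 l) ?tl' //= !mxE ir !eqxx tl' big1 ?addr0.
      by rewrite mul1r mulNr divfK // subrr mulr0.
    by move=> j /andP [/negbTE jt /negbTE jl]; rewrite mxE jt jl if_same mul0r.
  rewrite !mxE At // add0r -(val_eqE j t) -(val_eqE j l) /= (ltn_eqF jt).
  by rewrite (ltn_eqF (ltn_trans jt tl)) if_same mulr0.
move=> A [[x x0 [xk Ax]] At].
have [xt|xt] := eqVneq (x t 0) 0; first exact: (zero_case A x).
pose l : 'I_N := inord k.-1.
have kK : k.-1.+1 = k by apply: prednK; apply: leq_ltn_trans ltk.
have el : l = k.-1 :> nat by rewrite inordK // kK.
have tl : (t < l)%N by rewrite el -ltnS kK.
have [xl|xl] := eqVneq (x l 0) 0; last exact: (tail_case A x l).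
have [B [B0 AxB]] := kernel_shift xt xl Ax.
apply: (line_vanish (B := B) (g := 'X)); first by rewrite polyX_eq0.
move=> e; rewrite hornerX => e0.
apply: (tail_case _ (x + e *: delta_mx l 0) l) => //.
- apply/eqP => /matrixP /(_ l 0); rewrite !mxE xl !eqxx mulr1 add0r => /eqP.
  by rewrite (negbTE e0).
- move=> j kj; rewrite !mxE xk // add0r -(val_eqE j l) /= gtn_eqF ?mulr0 //.
  by rewrite el (leq_trans _ kj) // kK.
- by move=> i ri; apply: AxB.
- move=> i j ir jt; rewrite mxE (At i j ir jt) add0r mxE B0 ?mulr0 //.
  by rewrite -(val_eqE j t) /= ltn_eqF ?orbT.
- by rewrite !mxE xl !eqxx mulr1 add0r.
Qed.

Lemma rad_gens_minor r k t (rho : 'I_k -> 'I_N) :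
  (forall a, (r <= rho a)%N) ->
  rad_gens r k t k (\det (mxsub rho (fun b => inord b) Z)).
Proof. by move=> rrho; left; split=> //; exists rho. Qed.

Lemma rad_gens_entry (r : 'I_N) k t (j : 'I_N) :
  (j < t)%N -> rad_gens r k t 1%N (Z r j).
Proof. by move=> jt; right; split=> //; exists r, j; rewrite eqxx. Qed.

(** Append row [r] and column [k] to the minor and expand along row [r]: the last term is the given
    product, and the others contain entries of row [r] before column [k]. *)
Lemma corner_entry_mul_minor (r : 'I_N) k D a (rho : 'I_k -> 'I_N) :
  (k < N)%N -> (forall b, (r < rho b)%N) -> (msize a + k <= D)%N ->
  fspan (rad_gens r k.+1 k) D.+1
    (Z r (inord k) * (a * \det (mxsub rho (fun b => inord b) Z))).
Proof.
move=> kN rrho leD.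
pose rho' a := if unlift ord_max a is Some b then rho b else r.
pose M := mxsub rho' (fun b : 'I_k.+1 => inord b) Z.
have Mr j : M ord_max j = Z r (inord j) by rewrite mxE /rho' unlift_none.
have := expand_det_row M ord_max; rewrite big_ord_recr /= Mr /= => eM.
have cofM : cofactor M ord_max ord_max = \det (mxsub rho (fun b => inord b) Z).
  rewrite /cofactor addnn -signr_odd odd_double mul1r; congr (\det _).
  apply/matrixP => i j; rewrite 3!mxE [RHS]mxE /rho' liftK.
  by congr (Z _ (inord _)); rewrite lift_max.
have {eM}-> : Z r (inord k) * (a * \det (mxsub rho (fun b => inord b) Z)) =
    a * \det M - \sum_(j < k) (a * cofactor M ord_max (widen_ord (leqnSn k) j))
                               * Z r (inord j).
  move: (\det _) cofM => d cofM; rewrite eM cofM mulrDr mulr_sumr (mulrCA a).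
  rewrite [X in X - _]addrC.
  rewrite (eq_bigr (fun j => a * cofactor M ord_max (widen_ord (leqnSn k) j)
                               * Z r (inord j))) ?addrK // => j _.
  by rewrite Mr -mulrA; congr (_ * _); apply: mulrC.
apply: fspan_add.
  apply: (fspan_gen (d := k.+1)); last by rewrite addnS ltnS.
  apply: rad_gens_minor => b; rewrite /rho'; case: unlift => // c.
  exact: ltnW (rrho c).
rewrite -sumrN; apply: fspan_sum => j _; rewrite -mulNr.
apply: (fspan_gen (d := 1%N)).
  by apply: rad_gens_entry; rewrite inordK // (ltn_trans (ltn_ord j)).
rewrite addn1 ltnS msizeN; apply: leq_trans leD.
exact: msizeM_leS (msize_cofactor _ _ _ _).
Qed.

Lemma mulmx_supported k A (x : 'cV[F]_N) i : (k <= N)%N ->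
  (forall j : 'I_N, (k <= j)%N -> x j 0 = 0) ->
  (A *m x) i 0 = \sum_(b < k) A i (inord b) * x (inord b) 0.
Proof.
move=> kN xk; rewrite mxE (bigID (fun j : 'I_N => (j < k)%N)) /=.
rewrite [X in _ + X]big1 ?addr0; last first.
  by move=> j; rewrite -leqNgt => /xk ->; rewrite mulr0.
rewrite (big_ord_narrow kN); apply: eq_bigr => b _.
have -> : inord b = widen_ord kN b; last by [].
by apply: val_inj; rewrite /= inordK // (leq_trans (ltn_ord b)).
Qed.

Lemma dependent_minor r k A (rho : 'I_k -> 'I_N) : (k <= N)%N ->
  dependent r k A -> (forall a, (r <= rho a)%N) ->
  \det (mxsub rho (fun b => inord b) A) = 0.
Proof.
move=> kN [x x0 [xk Ax]] rrho; rewrite -det_tr; apply/eqP/det0P.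
exists (\row_a x (inord a) 0).
  apply: contraNneq x0 => /rowP x0; apply/eqP/colP => j; rewrite [RHS]mxE.
  have [jk|/xk //] := ltnP j k.
  by have := x0 (Ordinal jk); rewrite !mxE /= inord_val.
apply/rowP => a; rewrite [RHS]mxE -[RHS](Ax _ (rrho a)) (mulmx_supported _ _ kN xk) mxE.
by apply: eq_bigr => j _; rewrite !mxE mulrC.
Qed.

(* A polynomial f vanishing on the locus for t lies by induction in the ideal for
   t + 1, so f = j + b z_rt with j in the ideal for t and b of smaller degree.  If
   t + 1 < k, density shows that b vanishes on the locus for t too.  If t + 1 = k,
   then b vanishes where row r is zero before column t and the first t columns are
   dependent below row r, so up to entries of row r it is in the ideal of t-minors
   below row r, and z_rt times such a minor is a k-minor modulo these entries. *)
Lemma fspan_rad_gens r k D f : (r <= N)%N -> (k <= N)%N -> (msize f <= D)%N ->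
  (forall A, dependent r k A -> mxeval f A = 0) ->
  fspan (rad_gens r k 0) D f.
Proof.
move: {2}(N - r)%N (erefl (N - r)%N) => m; elim: m r k D f => [|m IHr] r k D f Nr rN kN.
  (* No rows are left: for [k = 0] the empty minor is 1, and for positive [k] every matrix is
     dependent, so [f] is zero. *)
  move=> leD f0; have [k0|k0] := posnP k.
    subst k; rewrite -[f]mulr1; apply: (fspan_gen (d := 0%N)); last by rewrite addn0.
    left; split=> //; exists (fun=> ord0); split=> [[]//|].
    by rewrite det_mx00.
  rewrite (mx_vanish (f := f)) ?msize0; first exact: Fspan0.
  move=> A; apply: f0; exists (delta_mx ord0 0).
    by apply/eqP => /matrixP /(_ ord0 0); rewrite !mxE /= => /eqP; rewrite oner_eq0.
  split=> [j|i]; first by rewrite mxE; case: j => -[|j] //= _; rewrite leqNgt k0.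
  by rewrite leqNgt (leq_trans (ltn_ord i)) // -subn_eq0 Nr.
have rltN : (r < N)%N by rewrite -subn_gt0 Nr.
have NrS : (N - r.+1 = m)%N by rewrite subnS Nr.
(* Here [k - t] entries of row [r] are adjoined; induction on [t] removes them one at a time,
   starting from all [k]. *)
suff H t : (t <= k)%N -> forall D f, (msize f <= D)%N ->
    (forall A, rad_locus r k (k - t) A -> mxeval f A = 0) ->
    fspan (rad_gens r k (k - t)) D f.
  move=> leD f0; have := H k (leqnn k); rewrite subnn; apply=> // A [depA _].
  exact: f0.
pose r0 := Ordinal rltN; rewrite -[r]/(nat_of_ord r0) in IHr NrS *.
elim: t => [|t IHt] tk {}D {}f.
  (* With its first [k] entries zero, row [r] imposes no condition on a relation among the first [k]
     columns, so the induction on the rows applies to [kill (mxpred T) f]. *)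
  rewrite subn0 => leD f0; pose T (i j : 'I_N) := (i == r0 :> nat) && (j < k)%N.
  rewrite -[f](subrK (kill (mxpred T) f)); apply: fspan_add.
    by apply: fspan_incl (kill_entries T leD) => // d g Tg; right.
  have lek := leq_trans (msize_kill (mxpred T) f) leD.
  apply: fspan_incl (IHr _ _ _ _ NrS rltN kN lek _) => //.
    move=> d g [[-> [rho [rrho ->]]]|[_ [i [j []]]]].
      by apply: rad_gens_minor => a; apply: ltnW.
    by rewrite ltn0 andbF.
  move=> A [x x0 [xk Ax]]; rewrite mxeval_kill; apply: f0; split.
    exists x => //; split=> // i; rewrite leq_eqVlt => /orP [/eqP ri|ri].
      rewrite mxE big1 // => j _; rewrite mxE /T -ri eqxx /=.
      by case: ltnP => [_|/xk ->]; rewrite ?mul0r ?mulr0.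
    rewrite -[RHS](Ax _ ri) !mxE; apply: eq_bigr => j _.
    by rewrite mxE /T gtn_eqF.
  by move=> i j ir jk; rewrite mxE /T ir eqxx jk.
have kt : (k - t = (k - t.+1).+1)%N by rewrite subnSK.
set s := (k - t.+1)%N in kt *; have sk : (s < k)%N by rewrite -kt leq_subr.
have sN : (s < N)%N := leq_trans sk kN.
pose s0 := Ordinal sN; have es : inord s = s0 by apply/val_inj; rewrite /= inordK.
elim: D f => [|D IHD] f leD f0.
  move: leD; rewrite leqn0 msize_poly_eq0 => /eqP ->; exact: Fspan0.
have {IHt} := IHt (ltnW tk) D.+1 f leD; rewrite kt => IHt.
have {}IHt : fspan (rad_gens r0 k s.+1) D.+1 f.
  apply: IHt => A [depA At]; apply: f0; split=> // i j ir js; apply: At => //.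
  exact: ltnW.
have {IHt} := fspan_split (G := rad_gens r0 k s) (x := Z r0 s0) _ IHt.
case=> [d g|b [j [ef sj leb]]].
  move=> [|[-> [i [j [/andP [/eqP ir js] ->]]]]]; first by left; left.
  have -> : i = r0 by apply: val_inj.
  move: js; rewrite ltnS leq_eqVlt => /orP [/eqP js|js].
    by right; split=> //; congr (Z _ _); apply: val_inj.
  by left; apply: rad_gens_entry.
rewrite ef; apply: fspan_add => //.
have jid : is_ideal [set g | forall A, rad_locus r0 k s A -> mxeval g A = 0].
  split=> [A _|g g' g0 g0' A VA|g g' g0 A VA]; first exact: meval0.
    by rewrite /mxeval mevalD [X in X + _]g0 ?[X in _ + X]g0' ?addr0.
  by rewrite /mxeval mevalM [X in _ * X]g0 ?mulr0.
have j0 : [set g | forall A, rad_locus r0 k s A -> mxeval g A = 0] j.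
  apply: fspan_ideal jid _ sj => d g.
  move=> [[_ [rho [rrho ->]]]|[_ [i [l [/andP [/eqP ir ls] ->]]]]] A [[x x0 [xk Ax]] At].
    by rewrite mxeval_det (@dependent_minor r0 k) //; exists x.
  by rewrite mxeval_Z At.
have b0 A : rad_locus r0 k s A -> A r0 s0 != 0 -> mxeval b A = 0.
  move=> VA nz; apply: (mulIf nz); rewrite mul0r -[A r0 s0]mxeval_Z -mevalM.
  have := f0 A VA; rewrite ef /mxeval mevalD.
  by have /= := j0 A VA; rewrite /mxeval => ->; rewrite add0r.
have [sk1|] := ltnP s.+1 k.
  rewrite mulrC -[D.+1]addn1; apply: fspan_mul; first by rewrite msize_Z.
  by apply: IHD => //; apply: (@rad_locus_dense r0 k s0); rewrite /= ?sk1.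
move=> ks; have {ks}kS : k = s.+1 by apply/eqP; rewrite eqn_leq sk ks.
pose T (i j : 'I_N) := (i == r0 :> nat) && (j < s)%N.
rewrite mulrC -(subrK (kill (mxpred T) b) b) mulrDr; apply: fspan_add.
  rewrite -[D.+1]addn1; apply: fspan_mul; first by rewrite msize_Z.
  apply: fspan_incl (kill_entries T leb) => // d g [-> [i [l [/andP [/eqP ir ls] ->]]]].
  by right; split=> //; exists i, l; rewrite ir eqxx.
have lek := leq_trans (msize_kill (mxpred T) b) leb.
have {IHr}: fspan (rad_gens r0.+1 s 0) D (kill (mxpred T) b).
  apply: IHr => // [|A [x x0 [xs Ax]]]; first exact: ltnW.
  rewrite mxeval_kill.
  (* Only the entry (r, s) moves; it does not meet the relation, which is supported before column
     [s]. *)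
  apply: (line_vanish (B := delta_mx r0 s0) (g := 'X + (A r0 s0)%:P)).
    by rewrite -size_poly_eq0 size_XaddC.
  move=> e; rewrite !hornerE addrC => nz; apply: b0; last first.
    by rewrite !mxE /T ltnn andbF !eqxx mulr1.
  split.
    exists x => //; split=> [l|i].
      by rewrite kS => /ltnW /xs.
    rewrite leq_eqVlt => /orP [/eqP ri|ri].
      rewrite mxE big1 // => l _; have [ls|/xs ->] := ltnP l s; last by rewrite mulr0.
      rewrite !mxE /T ls -ri eqxx add0r -(val_eqE l s0) /= (ltn_eqF ls) andbF.
      by rewrite mulr0 mul0r.
    rewrite -[RHS](Ax _ ri) !mxE; apply: eq_bigr => l _.
    by rewrite !mxE /T -(val_eqE i r0) /= gtn_eqF //= mulr0 addr0.
  move=> i l ir ls; rewrite !mxE /T ir eqxx ls add0r -(val_eqE l s0) /=.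
  by rewrite (ltn_eqF ls) andbF mulr0.
rewrite kS -es; apply: fspan_subM => d a g [[-> [rho [rrho ->]]]|]; last first.
  by move=> [_ [i [l []]]]; rewrite ltn0 andbF.
exact: corner_entry_mul_minor.
Qed.

End MatrixPolynomials.

(** * The ideals L and K *)

Section VanishingIdeals.
Variables (F : numFieldType) (n : nat).
Local Notation N := n.+1.
Local Notation mxpol := {mpoly F[N * N]}.
Implicit Types (f g : mxpol) (A B : 'M[F]_N) (I : set mxpol).
Local Notation Z := (Zmx F n).

Lemma vanishing_ideal (S : set 'M[F]_N) : is_ideal (vanishing S).
Proof.
split=> [A _|f g f0 g0 A SA|f g g0 A SA]; first exact: meval0.
  by rewrite /mxeval mevalD [X in X + _]f0 ?[X in _ + X]g0 ?addr0.
by rewrite /mxeval mevalM [X in _ * X]g0 ?mulr0.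
Qed.

Lemma vanishingS (S T : set 'M[F]_N) : S `<=` T -> vanishing T `<=` vanishing S.
Proof. by move=> ST f f0 A /ST; apply: f0. Qed.

Lemma vanishing_zclosure (S : set 'M[F]_N) : vanishing (zclosure S) = vanishing S.
Proof.
apply/seteqP; split=> [f f0 A SA|f f0 A cA]; last exact: cA.
by apply: f0 => g; apply.
Qed.

Lemma zeros_ideal_gen (S : set mxpol) A :
  (forall f, S f -> mxeval f A = 0) -> zeros (ideal_gen S) A.
Proof.
move=> A0 f Sf; have : vanishing [set A] f; last by apply.
by apply: ideal_gen_min Sf; [exact: vanishing_ideal|move=> g /A0 g0 _ ->].
Qed.

Lemma zeros_ideal_add I J : is_ideal I -> is_ideal J ->
  zeros (ideal_add I J) = zeros I `&` zeros J.
Proof.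
move=> idI idJ; apply/seteqP; split=> [A A0|A [AI AJ] _ [f [g [/AI f0 /AJ g0 ->]]]].
  by split=> f If; apply: A0; [exact: ideal_add_subl|exact: ideal_add_subr].
by rewrite /mxeval mevalD -![meval _ _]/(mxeval _ A) f0 g0 addr0.
Qed.

(** A repeated row gives 0; otherwise the rows are a permutation of those of some [p_minor], which
    costs a sign. *)
Lemma minor_K_ideal k (rho : 'I_k -> 'I_N) : (forall a, (0 < rho a)%N) ->
  K_ideal k (\det (mxsub rho (fun b => inord b) Z)).
Proof.
move=> rho0; have [K0 _ KM] := ideal_gen_ideal
  [set f | exists A : {set 'I_N}, [/\ ord0 \notin A, #|A| = k & f = p_minor F A]].
have [/injectiveP rhoI|/injectivePn [a [b ab rab]]] := boolP (injectiveb rho); last first.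
  by rewrite (determinant_alternate ab) // => c; rewrite !mxE rab.
pose A := [set rho a | a in 'I_k]%SET.
have A0 : ord0 \notin A.
  by apply/imsetP => -[a _ ra]; have := rho0 a; rewrite -ra.
have kA : #|A| = k by rewrite card_imset // card_ord.
have : forall a, rho a \in A by move=> a; apply: imset_f.
move: A kA A0 => A kA A0; subst k => Arho.
(* Without an index [k0] on which to base [enum_rank_in], both determinants have size 0. *)
have [k0 _|a0] := pickP (@predT 'I_#|A|); last first.
  apply: ideal_gen_sub; exists A; split=> //; congr (\det _); apply/matrixP => a.
  by move: (a0 a).
pose s a : 'I_#|A| := enum_rank_in (Arho k0) (rho a).
have sK a : enum_val (s a) = rho a by apply: enum_rankK_in.
have sI : injective s by move=> a b ab; apply: rhoI; rewrite -!sK ab.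
pose M : 'M[mxpol]_#|A| := \matrix_(a, b) Z (enum_val a) (inord b).
have -> : mxsub rho (fun b => inord b) Z = row_perm (perm sI) M.
  by apply/matrixP => a b; rewrite !mxE permE sK.
by rewrite row_permE det_mulmx; apply: KM; apply: ideal_gen_sub; exists A.
Qed.

Lemma K_ideal_minor k f : K_ideal k f ->
  ideal_gen [set f | exists2 rho : 'I_k -> 'I_N, (forall a, (0 < rho a)%N) &
               f = \det (mxsub rho (fun b => inord b) Z)] f.
Proof.
apply: ideal_gen_min; first exact: ideal_gen_ideal.
move=> g [A [A0 kA ->]]; subst k; apply: ideal_gen_sub; exists enum_val => [a|].
  rewrite lt0n; apply: contraNneq A0 => a0.
  by rewrite -[ord0](_ : enum_val a = _) ?enum_valP //; apply: val_inj.
by congr (\det _); apply/matrixP => a b; rewrite !mxE.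
Qed.

Lemma vanishing_dependent k : (k <= N)%N ->
  vanishing [set A : 'M[F]_N | dependent 1 k A] = K_ideal k.
Proof.
move=> kN; apply/seteqP; split=> [f f0|f /K_ideal_minor].
  apply: fspan_ideal (fspan_rad_gens (r := 1) _ kN (leqnn _) f0) => //.
    exact: ideal_gen_ideal.
  move=> d g [[_ [rho [rho0 ->]]]|[_ [i [j []]]]]; first exact: minor_K_ideal.
  by rewrite ltn0 andbF.
apply: ideal_gen_min => [|g [rho rho0 ->] A depA]; first exact: vanishing_ideal.
by rewrite mxeval_det (dependent_minor kN depA).
Qed.

(** If the first [k] columns with row 0 cleared had full rank, some [k] rows would give a nonzero
    minor; these rows avoid the cleared row 0, so the minor lies in [K_ideal k]. *)
Lemma zeros_K_ideal k : (k <= N)%N ->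
  zeros (K_ideal k) = [set A : 'M[F]_N | dependent 1 k A].
Proof.
move=> kN; apply/seteqP; split=> [A A0|A depA]; last first.
  by rewrite -vanishing_dependent // => f; apply.
pose M : 'M[F]_(N, k) := \matrix_(i, b) if i == ord0 then 0 else A i (inord b).
have nfull : ~~ row_full M.
  apply/negP => fullM; pose rho := fullrankfun fullM.
  have unitM : \det (rowsub rho M) != 0.
    by rewrite -unitfE -unitmxE; apply: fullrowsub_unit.
  have rho0 a : (0 < rho a)%N.
    rewrite lt0n; apply: contraNneq unitM => ra.
    rewrite (expand_det_row _ a) big1 // => b _; rewrite !mxE.
    by rewrite -val_eqE /= ra eqxx mul0r.
  case/eqP: unitM; rewrite -(A0 _ (minor_K_ideal rho0)) mxeval_det.
  congr (\det _); apply/matrixP => a b; rewrite !mxE.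
  by rewrite -val_eqE /= gtn_eqF.
have : ~~ row_free M^T by rewrite /row_free mxrank_tr.
rewrite -kermx_eq0 => /rowV0Pn [v /sub_kermxP vM v0].
pose x : 'cV[F]_N := \col_j if insub (j : nat) is Some b then v 0 b else 0.
have xE (b : 'I_k) : x (inord b) 0 = v 0 b.
  rewrite mxE inordK ?(leq_trans (ltn_ord b)) //.
  by case: insubP => [c _ cb|]; [congr (v 0 _); apply: val_inj|rewrite ltn_ord].
have xk (j : 'I_N) : (k <= j)%N -> x j 0 = 0.
  by move=> kj; rewrite mxE insubN // -leqNgt.
exists x; first by apply: contraNneq v0 => x0; apply/eqP/rowP => b; rewrite -xE x0 !mxE.
split=> // i i0; rewrite (mulmx_supported _ _ kN xk).
transitivity ((v *m M^T) 0 i); last by rewrite vM mxE.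
by rewrite mxE; apply: eq_bigr => b _; rewrite xE !mxE -val_eqE /= gtn_eqF // mulrC.
Qed.

Definition row0_zero k : set 'M[F]_N :=
  [set A | forall j : 'I_N, (j < k)%N -> A ord0 j = 0].

Definition row0 k : 'I_N -> 'I_N -> bool := fun i j => (i == ord0) && (j < k)%N.

Lemma zeros_L_ideal k : zeros (L_ideal k) = row0_zero k.
Proof.
apply/seteqP; split=> [A A0 j jk|A A0].
  by rewrite -mxeval_Z; apply: A0; apply: ideal_gen_sub; exists j.
by apply: zeros_ideal_gen => _ [j jk ->]; rewrite mxeval_Z A0.
Qed.

Lemma kill_L_ideal k f : L_ideal k (f - kill (mxpred (row0 k)) f).
Proof.
apply: fspan_ideal (kill_entries (row0 k) (leqnn (msize f))) => //.
  exact: ideal_gen_ideal.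
move=> d g [_ [i [j [/andP [/eqP -> jk] ->]]]].
by apply: ideal_gen_sub; exists j.
Qed.

Lemma kill_row0_L k f : L_ideal k f -> kill (mxpred (row0 k)) f = 0.
Proof.
move=> Lf; suff : is_ideal [set f : mxpol | kill (mxpred (row0 k)) f = 0].
  move/ideal_gen_min; apply; last exact: Lf.
  by move=> _ [j jk ->] /=; rewrite kill_Z /row0 eqxx jk.
split=> [|g g' /= g0 g0'|g g' /= g0]; first exact: rmorph0.
  by rewrite rmorphD /= g0 g0' addr0.
by rewrite rmorphM /= g0 mulr0.
Qed.

Lemma row0_zero_zeroing k A : row0_zero k (zeroing (row0 k) A).
Proof. by move=> j jk; rewrite mxE /row0 eqxx jk. Qed.

Lemma vanishing_row0_zero k : vanishing (row0_zero k) = L_ideal k.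
Proof.
apply/seteqP; split=> [f f0|f Lf A]; last by rewrite -zeros_L_ideal; apply.
have := kill_L_ideal k f; rewrite (mx_vanish (f := kill _ f)) ?subr0 // => A.
by rewrite mxeval_kill; apply/f0/row0_zero_zeroing.
Qed.

Lemma dependent_zeroing k l A : dependent 1 l A -> dependent 1 l (zeroing (row0 k) A).
Proof.
move=> [x x0 [xl Ax]]; exists x => //; split=> // i i0.
rewrite -[RHS](Ax _ i0) !mxE; apply: eq_bigr => j _.
by rewrite mxE /row0 -val_eqE /= gtn_eqF.
Qed.

(** Clearing the start of row 0 does not affect the rows below, so killing these variables in [f]
    gives a polynomial vanishing on the whole dependent locus; the difference lies in
    [L_ideal k]. *)
Lemma vanishing_LK k l : (l <= N)%N ->
  vanishing (row0_zero k `&` [set A : 'M[F]_N | dependent 1 l A]) =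
  ideal_add (L_ideal k) (K_ideal l).
Proof.
move=> lN; apply/seteqP; split=> [f f0|].
  exists (f - kill (mxpred (row0 k)) f), (kill (mxpred (row0 k)) f).
  split; [exact: kill_L_ideal| |by rewrite subrK].
  rewrite -vanishing_dependent // => A depA; rewrite mxeval_kill; apply: f0.
  by split; [exact: row0_zero_zeroing|exact: dependent_zeroing].
apply: ideal_add_min; first exact: vanishing_ideal.
  by rewrite -vanishing_row0_zero; apply: vanishingS; apply: subIsetl.
by rewrite -vanishing_dependent //; apply: vanishingS; apply: subIsetr.
Qed.

Definition LK_products k l : set mxpol :=
  [set f | exists2 j : 'I_N, (j < k)%N & exists A : {set 'I_N},
     [/\ ord0 \notin A, #|A| = l & f = Z ord0 j * p_minor F A]].

Lemma LK_mul k l f g : L_ideal k f -> K_ideal l g ->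
  ideal_gen (LK_products k l) (f * g).
Proof.
have [P0 PD PM] := ideal_gen_ideal (LK_products k l).
move=> Lf Kg.
suff : is_ideal [set f | ideal_gen (LK_products k l) (f * g)].
  move/ideal_gen_min; apply; last exact: Lf; move=> _ [j jk ->] /=.
  suff : is_ideal [set g | ideal_gen (LK_products k l) (Z ord0 j * g)].
    move/ideal_gen_min; apply; last exact: Kg; move=> _ [A [A0 lA ->]] /=.
    by apply: ideal_gen_sub; exists j => //; exists A.
  split=> [|a b /= Pa Pb|a b /= Pb]; first by rewrite /= mulr0.
    by rewrite mulrDr; apply: PD.
  by rewrite mulrCA; apply: PM.
split=> [|a b /= Pa Pb|a b /= Pb]; first by rewrite /= mul0r.
  by rewrite mulrDl; apply: PD.
by rewrite -mulrA; apply: PM.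
Qed.

Lemma LK_products_sub k l (I : set mxpol) : is_ideal I ->
  L_ideal k `<=` I \/ K_ideal l `<=` I -> ideal_gen (LK_products k l) `<=` I.
Proof.
move=> idI; have [_ _ IM] := idI.
move=> LKI; apply: ideal_gen_min => // _ [j jk [A [A0 lA ->]]].
case: LKI => sub; last by apply/IM/sub/ideal_gen_sub; exists A.
by rewrite mulrC; apply/IM/sub/ideal_gen_sub; exists j.
Qed.

(* The generators of K do not involve the variables generating L, so killing
   the latter in an expression of f in K changes the coefficients by elements
   of L and turns f into 0. *)
Lemma LK_inter k l : L_ideal k `&` K_ideal l `<=` ideal_gen (LK_products k l).
Proof.
have [P0 PD PM] := ideal_gen_ideal (LK_products k l).
move=> f [Lf Kf]; pose e : mxpol -> mxpol := kill (mxpred (row0 k)).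
suff [_ H] : K_ideal l (e f) /\ ideal_gen (LK_products k l) (f - e f).
  by move: H; rewrite /e (kill_row0_L Lf) subr0.
have [K0 KD KM] := ideal_gen_ideal [set f | exists A : {set 'I_N},
  [/\ ord0 \notin A, #|A| = l & f = p_minor F A]].
suff : is_ideal [set g | K_ideal l (e g) /\ ideal_gen (LK_products k l) (g - e g)].
  move/ideal_gen_min; apply; last exact: (K_ideal_minor Kf).
  move=> _ [rho rho0 ->] /=; rewrite /e kill_det ?subrr.
    by split=> //; apply: minor_K_ideal.
  by move=> a b; rewrite /row0 -val_eqE /= gtn_eqF.
split=> [|a b [Ka Pa] [Kb Pb]|a b [Kb Pb]] /=; first by rewrite /e rmorph0 subrr.
  by rewrite /e rmorphD /= opprD addrACA; split; [exact: KD|exact: PD].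
rewrite /e rmorphM /=; split; first exact: KM.
have -> : a * b - e a * e b = a * (b - e b) + (a - e a) * e b.
  by rewrite mulrBr mulrBl addrA subrK.
by apply: PD; [exact: PM|apply: LK_mul => //; exact: kill_L_ideal].
Qed.

End VanishingIdeals.

(** * Bruhat cells *)

Section ShortPermutations.
Variable n : nat.
Local Notation N := n.+1.
Implicit Types (k a b : 'I_N) (w : 'S_N).

Definition inversion_set w : {set 'I_N * 'I_N} :=
  [set p : 'I_N * 'I_N | (p.1 < p.2)%N && (w p.2 < w p.1)%N]%SET.

(* Since u k is minimal, every pair (a, k) with a < k is an inversion, and these
   are the only inversions of the cycle lift_perm k ord0 1. *)
Lemma u_shortE k : u_short k k = ord0 /\
  forall a b, (a < b)%N -> (u_short k b < u_short k a)%N -> b = k.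
Proof.
pose S := [set (a, k) | a in [pred a : 'I_N | (a < k)%N]]%SET.
have sub w : w k = ord0 -> S \subset inversion_set w.
  move=> wk; apply/fintype.subsetP => p /imsetP [a ak ->]; rewrite inE in ak.
  rewrite inE /= wk.
  rewrite ak lt0n; apply: contraTneq ak => wa.
  have -> : a = k by apply: (@perm_inj _ w); rewrite wk; apply: val_inj.
  by rewrite ltnn.
pose w := lift_perm k ord0 (1%g : 'S_n).
have wk : w k == ord0 by rewrite lift_perm_id.
have invw : inversion_set w \subset S.
  apply/fintype.subsetP => -[a b]; rewrite inE /= => /andP [ab].
  have [b' eb|eb _] := unliftP k b; last by apply/imsetP; exists a; rewrite ?inE -?eb.
  have [a' ea|->] := unliftP k a; last by rewrite lift_perm_id.
  move: ab; rewrite ea eb !lift_perm_lift !perm1 !lift0 /= /bump.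
  case: leqP => ka; case: leqP => kb; lia.
rewrite /u_short; case: arg_minnP => [|u /eqP uk umin]; first by rewrite tpermL.
split=> // a b ab uab.
have /eqP eS : S == inversion_set u.
  by rewrite eqEcard sub //= (leq_trans (umin w wk)) // subset_leq_card.
have : (a, b) \in S by rewrite eS inE /= ab.
by case/imsetP => c _ [].
Qed.

(** Dually to [u_shortE]: each pair (k, b) with k < b is an inversion, and [lift_perm k ord_max 1]
    has no others, so minimality leaves exactly these. *)
Lemma v_shortE k : v_short k k = ord_max /\
  forall a b, (a < b)%N -> (v_short k b < v_short k a)%N -> a = k.
Proof.
pose S := [set (k, b) | b in [pred b : 'I_N | (k < b)%N]]%SET.
have sub w : w k = ord_max -> S \subset inversion_set w.
  move=> wk; apply/fintype.subsetP => p /imsetP [b kb ->]; rewrite inE in kb.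
  rewrite inE /= wk.
  rewrite kb ltn_neqAle -ltnS ltn_ord andbT; apply: contraTneq kb => wb.
  have -> : b = k by apply: (@perm_inj _ w); rewrite wk; apply: val_inj.
  by rewrite ltnn.
pose w := lift_perm k ord_max (1%g : 'S_n).
have wk : w k == ord_max by rewrite lift_perm_id.
have invw : inversion_set w \subset S.
  apply/fintype.subsetP => -[a b]; rewrite inE /= => /andP [ab].
  have [a' ea|ea _] := unliftP k a; last by apply/imsetP; exists b; rewrite ?inE -?ea.
  have [b' eb|->] := unliftP k b; last first.
    by rewrite lift_perm_id ltnNge /= -ltnS ltn_ord.
  move: ab; rewrite ea eb !lift_perm_lift !perm1 !lift_max /= /bump.
  case: leqP => ka; case: leqP => kb; lia.
rewrite /v_short; case: arg_minnP => [|v /eqP vk vmin]; first by rewrite tpermL.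
split=> // a b ab vab.
have /eqP eS : S == inversion_set v.
  by rewrite eqEcard sub //= (leq_trans (vmin w wk)) // subset_leq_card.
have : (a, b) \in S by rewrite eS inE /= ab.
by case/imsetP => c _ [].
Qed.

End ShortPermutations.

Lemma ord_gt0 n (i : 'I_n.+1) : (0 < i)%N = (i != ord0).
Proof. by rewrite lt0n -val_eqE. Qed.

Section Triangular.
Variables (F : fieldType) (m : nat).
Implicit Types M : 'M[F]_m.

(** In the entry (i, j) above the diagonal of [M *m invmx M], the terms l < i vanish by induction on
    the row and the terms l > i by triangularity; the diagonal factor is nonzero. *)
Lemma trig_invmx M : M \in unitmx -> is_trig_mx M -> is_trig_mx (invmx M).
Proof.
move=> uM /is_trig_mxP trM.
have M0 i : M i i != 0.
  move: uM; rewrite unitmxE det_trig ?unitfE; last exact/is_trig_mxP.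
  by move/prodf_neq0/(_ i isT).
apply/is_trig_mxP => i; have [s] := ubnP (val i); elim: s i => // s IH i /ltnSE is_ j ij.
have := congr1 (fun X : 'M_m => X i j) (mulmxV uM); rewrite !mxE.
rewrite (bigD1 i) //= big1 ?addr0 => [/eqP|l li].
  by rewrite -(val_eqE i j) /= (ltn_eqF ij) mulf_eq0 (negbTE (M0 i)) => /eqP.
have [il|] := ltnP i l; first by rewrite trM ?mul0r.
rewrite leq_eqVlt val_eqE (negbTE li) /= => lti.
by rewrite (IH l (leq_trans lti is_) j (ltn_trans lti ij)) mulr0.
Qed.

End Triangular.

(** * Gaussian elimination into cells and vanishing ideals of cells *)

Section Cells.
Variables (F : numFieldType) (n : nat).
Local Notation N := n.+1.
Local Notation mxpol := {mpoly F[N * N]}.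
Implicit Types (f g : mxpol) (A B : 'M[F]_N) (w : 'S_N).
Local Notation Z := (Zmx F n).

Lemma borel_invmx A : borel A -> borel (invmx A).
Proof.
move=> [uA tA]; split; first by rewrite unitmx_inv.
by rewrite trmx_inv; apply: trig_invmx => //; rewrite unitmx_tr.
Qed.

Lemma borelE A (i j : 'I_N) : borel A -> (j < i)%N -> A i j = 0.
Proof. by move=> [_ /is_trig_mxP tA] ji; rewrite -(tA j i ji) mxE. Qed.

Definition lead A k : 'M_k := mxsub (fun a => inord a) (fun b => inord b) A.

(* Row i is cleared left of the diagonal by the rows above it. *)
Lemma row_elimination A : (forall k, (k <= N)%N -> \det (lead A k) != 0) ->
  exists E : 'M[F]_N,
    [/\ is_trig_mx E, forall i, E i i = 1,
        forall i j : 'I_N, (j < i)%N -> (E *m A) i j = 0 &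
        forall i : 'I_N, (forall j : 'I_N, (j < i)%N -> A i j = 0) ->
          forall j : 'I_N, (j < i)%N -> E i j = 0].
Proof.
move=> leadA.
pose r (i : 'I_N) : 'rV_i := \row_b A i (inord b).
(* The coefficients solve [c i *m lead A i = - r i]. *)
pose c (i : 'I_N) : 'rV_i := - (r i *m invmx (lead A i)).
pose E : 'M[F]_N := \matrix_(i, j)
  if insub (j : nat) is Some a then c i 0 a else (i == j)%:R.
have Elt (i j : 'I_N) (ji : (j < i)%N) : E i j = c i 0 (Ordinal ji).
  by rewrite mxE insubT.
have Ege (i j : 'I_N) : (i <= j)%N -> E i j = (i == j)%:R.
  by move=> ij; rewrite mxE insubN // -leqNgt.
exists E; split.
- by apply/is_trig_mxP => i j ij; rewrite (Ege i j (ltnW ij)) -(val_eqE i j) /= ltn_eqF.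
- by move=> i; rewrite (Ege i i (leqnn i)) eqxx.
- move=> i j ji; rewrite mxE (bigID (fun l : 'I_N => (l < i)%N)) /=.
  rewrite (bigD1 (P := fun l : 'I_N => ~~ (l < i)%N) i) ?ltnn //= [X in _ + (_ + X)]big1.
    rewrite addr0 (Ege i i (leqnn i)) eqxx mul1r (big_ord_narrow (ltnW (ltn_ord i))).
    transitivity ((c i *m lead A i) 0 (Ordinal ji) + A i j).
      congr (_ + _); rewrite mxE; apply: eq_bigr => a _.
      rewrite (Elt i (widen_ord _ a) (ltn_ord a)); congr (_ * _).
        by congr (c i 0 _); apply: val_inj.
      rewrite /lead mxE /= inord_val; congr (A _ j); apply: val_inj => /=.
      by rewrite inordK // (ltn_trans (ltn_ord a)).
    rewrite /c mulNmx mulmxKV ?unitmxE ?unitfE ?leadA 1?ltnW //.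
    by rewrite !mxE /= inord_val addNr.
  move=> l /andP [li nl]; have il : (i <= l)%N by rewrite leqNgt.
  by rewrite (Ege i l il) eq_sym (negbTE nl) mul0r.
- move=> i Ai j ji; rewrite (Elt i j ji).
  have ri : r i = 0.
    by apply/rowP => b; rewrite !mxE Ai // inordK // (ltn_trans (ltn_ord b)).
  by rewrite /c ri mul0mx oppr0 mxE.
Qed.

Lemma permutation_matrixE w : permutation_matrix F w = perm_mx w^-1.
Proof.
apply/matrixP => i j; rewrite !mxE; congr (nat_of_bool _)%:R.
by rewrite -[X in _ == X](permKV w) (inj_eq perm_inj) eq_sym.
Qed.

(** All leading minors after permuting the rows by [w]; sizes go up to [N], so the full determinant
    is, up to sign, a factor. *)
Definition cell_minors w : mxpol :=
  \prod_(k < N.+1) \det (mxsub (fun a : 'I_k => w (inord a)) (fun b => inord b) Z).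

Lemma cell_minors_lead w A : mxeval (cell_minors w) A != 0 ->
  forall k, (k <= N)%N -> \det (lead (row_perm w A) k) != 0.
Proof.
rewrite /mxeval /cell_minors rmorph_prod /= => /prodf_neq0 H k kN.
have := H (Ordinal (kN : (k < N.+1)%N)) isT.
rewrite -/(mxeval _ A) mxeval_det; congr (\det _ != 0).
by apply/matrixP => a b; rewrite !mxE.
Qed.

Lemma cell_minors_perm w : mxeval (cell_minors w) (permutation_matrix F w) != 0.
Proof.
rewrite /mxeval /cell_minors rmorph_prod /=; apply/prodf_neq0 => k _.
rewrite -/(mxeval _ _) mxeval_det (_ : mxsub _ _ _ = 1%:M) ?det1 ?oner_eq0 //.
apply/matrixP => a b; rewrite !mxE (inj_eq perm_inj) eq_sym -!val_eqE /=.
by rewrite !inordK // (leq_trans (ltn_ord _)) // -ltnS.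
Qed.

(** Conjugation by the permutation matrix of [w]. *)
Definition conj_perm w A : 'M[F]_N := row_perm w^-1 (col_perm w^-1 A).

Lemma conj_permE w A i j : conj_perm w A (w i) (w j) = A i j.
Proof. by rewrite !mxE !permK. Qed.

Lemma conj_perm_mul w A : conj_perm w A = perm_mx w^-1 *m (A *m perm_mx w).
Proof. by rewrite /conj_perm row_permE col_permE invgK. Qed.

(** With b = E w^-1 A upper triangular, A = (w E w^-1)^-1 w b. Membership in a cell then only needs
    w E w^-1 to be triangular of the right kind. *)
Lemma cell_factor w A E : is_trig_mx E -> (forall i, E i i = 1) ->
  A \in unitmx -> (forall i j : 'I_N, (j < i)%N -> (E *m row_perm w A) i j = 0) ->
  [/\ conj_perm w E \in unitmx, borel (E *m row_perm w A) &
      A = invmx (conj_perm w E) *m permutation_matrix F w *m (E *m row_perm w A)].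
Proof.
move=> tE E1 uA EA.
have uE : E \in unitmx.
  by rewrite unitmxE det_trig // big1 ?unitr1 // => i _; rewrite E1.
have uC : conj_perm w E \in unitmx by rewrite conj_perm_mul !unitmx_mul !unitmx_perm uE.
split=> //.
  split; first by rewrite row_permE !unitmx_mul unitmx_perm uE.
  by apply/is_trig_mxP => i j ij; rewrite mxE EA.
rewrite -mulmxA; apply: (canRL (mulKmx uC)).
by rewrite permutation_matrixE row_permE conj_perm_mul -!mulmxA.
Qed.

Lemma lead_full A : lead A N = A.
Proof. by apply/matrixP => i j; rewrite mxE !inord_val. Qed.

Lemma cell_minors_unit w A : mxeval (cell_minors w) A != 0 -> A \in unitmx.
Proof.
move/cell_minors_lead/(_ N (leqnn _)); rewrite lead_full row_permE det_mulmx.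
by rewrite mulf_eq0 negb_or unitmxE unitfE => /andP [].
Qed.

(** Row 0 of the product is a multiple of row [k] of the upper triangular factor. *)
Lemma op_cell_row0 (k : 'I_N) :
  double_coset (@borel_op F n) (@borel F n) (u_short k) `<=` row0_zero k.
Proof.
move=> _ [a [b [[ua /is_trig_mxP ta] bb ->]]] j jk; have [uk _] := u_shortE k.
rewrite -mulmxA mxE (bigD1 ord0) //= big1 ?addr0; last first.
  by move=> l l0; rewrite ta ?mul0r // ord_gt0.
rewrite mxE (bigD1 k) //= (borelE bb jk) mulr0 add0r big1 ?mulr0 // => l lk.
by rewrite mxE -uk (inj_eq perm_inj) (negbTE lk) mul0r.
Qed.

(** An entry of the conjugate of [E] above the diagonal comes from an entry of [E] that is 0 by
    triangularity or sits at an inversion, thus in row [k]. Row [k] of the permuted matrix is row 0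
    of [A], already zero before column [k], so elimination leaves it alone. *)
Lemma cell_minors_op (k : 'I_N) A : row0_zero k A ->
  mxeval (cell_minors (u_short k)) A != 0 ->
  double_coset (@borel_op F n) (@borel F n) (u_short k) A.
Proof.
move=> Ak mA; have [uk invk] := u_shortE k.
have [E [tE E1 EA E0]] := row_elimination (cell_minors_lead mA).
have [uC bB eA] := cell_factor tE E1 (cell_minors_unit mA) EA.
exists (invmx (conj_perm (u_short k) E)), (E *m row_perm (u_short k) A); split=> //.
split; first by rewrite unitmx_inv.
apply: trig_invmx => //; apply/is_trig_mxP => i j.
rewrite -(permKV (u_short k) i) -(permKV (u_short k) j) conj_permE.
set i' := ((u_short k)^-1)%g i; set j' := ((u_short k)^-1)%g j => uij.
have [ij'|ji'|/val_inj ij'] := ltngtP i' j'.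
- by move/is_trig_mxP: tE => ->.
- have ik := invk _ _ ji' uij; apply: E0 => // l.
  by rewrite ik => lk; rewrite mxE uk Ak.
- by move: uij; rewrite ij' ltnn.
Qed.

(** The line from a point of the linear space [row0_zero k] to the permutation matrix stays in that
    space and meets the cell generically. *)
Lemma vanishing_op_cell (k : 'I_N) :
  vanishing (double_coset (@borel_op F n) (@borel F n) (u_short k)) = L_ideal k.
Proof.
rewrite -vanishing_row0_zero; apply/seteqP; split; last first.
  exact/vanishingS/op_cell_row0.
move=> f f0 A Ak; have [uk _] := u_shortE k.
pose P := permutation_matrix F (u_short k).
have Pk : row0_zero k P.
  by move=> j jk; rewrite mxE -uk (inj_eq perm_inj) -val_eqE /= ltn_eqF.
pose C := map_mx polyC A + 'X *: map_mx polyC (P - A).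
have eC e : map_mx (horner^~ e) C = A + e *: (P - A).
  by apply/matrixP => i j; rewrite !mxE !hornerE.
have -> : A = map_mx (horner^~ 0) C by rewrite eC scale0r addr0.
apply: (@mxcurve_dense _ _ C (cell_minors (u_short k)) f 1) => [|e].
  by rewrite eC scale1r subrKC cell_minors_perm.
rewrite eC => mA; apply: f0; apply: cell_minors_op mA => j jk.
rewrite mxE [X in _ + X]mxE [(P - A) _ _]mxE [(- A) _ _]mxE Ak // Pk //.
by rewrite subrr mulr0 addr0.
Qed.

(** [w0] reverses the order, so the inversions of [v_short k] become the pairs kept in order, and
    all of them start at [k]. *)
Lemma w0_v_short (k : 'I_N) : (v_short k * w0 n)%g k = ord0 /\
  forall i j : 'I_N, (j < i)%N ->
   ((v_short k * w0 n)%g j < (v_short k * w0 n)%g i)%N -> j = k.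
Proof.
have [vk invk] := v_shortE k; split=> [|i j ji].
  by rewrite permM permE vk; apply: val_inj; rewrite /= subnn.
rewrite !permM !permE /= => lt; apply: (invk _ _ ji); lia.
Qed.

(** The relation is b^-1 applied to the unit vector of [k]: the product sends it to column 0 of the
    upper triangular [a], which is zero below row 0. *)
Lemma cell_dependent (k : 'I_N) :
  double_coset (@borel F n) (@borel F n) (v_short k * w0 n)%g `<=`
  [set A | dependent 1 k.+1 A].
Proof.
move=> _ [a [b [ba bb ->]]]; have [wk _] := w0_v_short k.
set w := (v_short k * w0 n)%g in wk *.
have bV := borel_invmx bb; have ub := bb.1.
exists (invmx b *m delta_mx k 0).
  apply/eqP => /(congr1 (mulmx b)); rewrite mulKVmx // mulmx0 => /matrixP /(_ k 0) /eqP.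
  by rewrite !mxE !eqxx oner_eq0.
split=> [j kj|i i0]; first by rewrite -colE mxE (borelE bV).
rewrite -!mulmxA mulKVmx // permutation_matrixE -row_permE mxE big1 // => l _.
rewrite !mxE eqxx andbT; have [lk|] := eqVneq _ k; last by rewrite mulr0.
by rewrite -(permKV w l) lk wk (borelE ba) ?mul0r.
Qed.

(** Only the entries of [E] in column [k] below the diagonal can obstruct triangularity of its
    conjugate. As [A] is invertible, it maps the relation [x] to a nonzero multiple of the unit
    vector of row 0, which [row_perm w] moves to row [k]; since E w^-1 A is upper triangular and [x]
    ends at [k], these entries vanish. *)
Lemma cell_minors_cell (k : 'I_N) A : dependent 1 k.+1 A ->
  mxeval (cell_minors (v_short k * w0 n)%g) A != 0 ->
  double_coset (@borel F n) (@borel F n) (v_short k * w0 n)%g A.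
Proof.
move=> [x x0 [xk Ax]] mA; have [wk invk] := w0_v_short k.
set w := (v_short k * w0 n)%g in wk invk mA *.
have uA := cell_minors_unit mA.
have [E [tE E1 EA _]] := row_elimination (cell_minors_lead mA).
have [uC bB eA] := cell_factor tE E1 uA EA.
exists (invmx (conj_perm w E)), (E *m row_perm w A); split=> //.
have Ax0 : (A *m x) ord0 0 != 0.
  apply: contraNneq x0 => Ax0; apply/eqP/(row_full_inj (A := A)).
    by rewrite row_full_unit.
  rewrite mulmx0; apply/colP => i; rewrite [RHS]mxE.
  by have [-> //|i0] := eqVneq i ord0; rewrite Ax ?ord_gt0.
have E0 (i : 'I_N) : (k < i)%N -> E i k = 0.
  move=> ki; apply: (mulIf Ax0); rewrite mul0r.
  transitivity ((E *m row_perm w A *m x) i 0); last first.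
    rewrite mxE big1 // => j _; have [ji|ij] := ltnP j i; first by rewrite EA ?mul0r.
    by rewrite xk ?mulr0 // (leq_trans ki).
  rewrite -mulmxA row_permE -mulmxA -row_permE [RHS]mxE [RHS](bigD1 k) //= big1 ?addr0.
    by rewrite [X in _ = _ * X]mxE wk.
  move=> j jk; rewrite [X in _ * X]mxE Ax ?mulr0 //.
  by rewrite ord_gt0 -wk (inj_eq perm_inj).
apply: borel_invmx; split=> //; apply/is_trig_mxP => i j.
rewrite mxE -(permKV w i) -(permKV w j) conj_permE.
set i' := (w^-1)%g i; set j' := (w^-1)%g j => wij.
have [ij'|ji'|/val_inj ij'] := ltngtP i' j'.
- by have jk := invk _ _ ij' wij; rewrite jk; apply: E0; rewrite -jk.
- by move/is_trig_mxP: tE => ->.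
- by move: wij; rewrite ij' ltnn.
Qed.

(* A point whose kernel vector x has x k != 0 is joined to the permutation matrix P
   of w by a curve in the locus: interpolate linearly all the entries but those of
   column k below row 0, which are determined by the kernel vector. *)
Lemma LK_dense w (i k : 'I_N) g f : (i <= k)%N -> w k = ord0 ->
  mxeval g (permutation_matrix F w) != 0 ->
  (forall A, row0_zero i A -> dependent 1 k.+1 A -> mxeval g A != 0 ->
     mxeval f A = 0) ->
  forall A, row0_zero i A -> dependent 1 k.+1 A -> mxeval f A = 0.
Proof.
move=> ik wk gP f0; set P := permutation_matrix F w in gP.
have curve_case A (x : 'cV[F]_N) : row0_zero i A -> x k 0 != 0 ->
    (forall j : 'I_N, (k < j)%N -> x j 0 = 0) ->
    (forall r : 'I_N, (1 <= r)%N -> (A *m x) r 0 = 0) -> mxeval f A = 0.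
  move=> A0 xk xgt Ax.
  (* The relation is deformed too: coordinate [k] stays and the others are scaled by 1 - e, so at e
     = 1 it fits [P]. *)
  pose B e := A + e *: (P - A).
  pose D e : 'M[F]_N := \matrix_(r, j)
    if (r != ord0) && (j == k)
    then - (x k 0)^-1 * \sum_(l | l != k) B e r l * ((1 - e) * x l 0) else B e r j.
  pose BX r j := (A r j)%:P + 'X * ((P - A) r j)%:P.
  pose C : 'M[{poly F}]_N := \matrix_(r, j)
    if (r != ord0) && (j == k)
    then (- (x k 0)^-1)%:P * \sum_(l | l != k) BX r l * ((1 - 'X) * (x l 0)%:P)
    else BX r j.
  have eB e r j : (BX r j).[e] = B e r j by rewrite /BX !hornerE !mxE.
  have eC e : map_mx (horner^~ e) C = D e.
    apply/matrixP => r j; rewrite [RHS]mxE 2!mxE; case: ifP => _; last exact: eB.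
    rewrite hornerM hornerC horner_sum; congr (_ * _); apply: eq_bigr => l _.
    by rewrite hornerM eB !hornerE.
  have AD : A = D 0.
    apply/matrixP => r j; rewrite mxE /B scale0r addr0 subr0.
    case: ifP => // /andP [r0 /eqP ->]; apply: (mulIf xk).
    rewrite mulrAC mulNr mulVf // mulN1r; apply/eqP; rewrite -addr_eq0.
    rewrite -[X in _ == X](Ax r) ?lt0n // mxE [X in _ == X](bigD1 k) //=.
    by apply/eqP; congr (_ + _); apply: eq_bigr => l _; rewrite mul1r.
  have PD : P = D 1.
    apply/matrixP => r j; rewrite [RHS]mxE /B scale1r subrKC.
    case: ifP => // /andP [r0 /eqP ->]; rewrite big1 ?mulr0.
      by rewrite mxE wk eq_sym (negbTE r0).
    by move=> l _; rewrite subrr mul0r mulr0.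
  rewrite AD -eC; apply: (mxcurve_dense (e0 := 1) (g := g)).
    by rewrite eC -PD.
  move=> e; rewrite eC; apply: f0.
    move=> j ji; rewrite mxE eqxx /= /B !mxE A0 // add0r subr0.
    by rewrite -wk (inj_eq perm_inj) -val_eqE /= ltn_eqF ?mulr0 // (leq_trans ji).
  exists (\col_l if l == k then x k 0 else (1 - e) * x l 0).
    by apply: contraNneq xk => /matrixP /(_ k 0); rewrite !mxE eqxx => ->.
  split=> [j kj|r r0].
    by rewrite mxE -val_eqE /= gtn_eqF // xgt // mulr0.
  rewrite mxE (bigD1 k) //= !mxE !eqxx andbT -val_eqE /= -lt0n r0.
  rewrite mulrAC mulNr mulVf // mulN1r addrC; apply/eqP; rewrite subr_eq0; apply/eqP.
  by apply: eq_bigr => l lk; rewrite !mxE (negbTE lk) andbF.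
move=> A A0 [x x0 [xk Ax]].
have [xk0|] := eqVneq (x k 0) 0; last by move=> nz; apply: (curve_case A x).
have [t xt] : exists t, x t 0 != 0.
  apply/existsP; apply: contraNT x0; rewrite negb_exists => /forallP x0.
  by apply/eqP/colP => j; rewrite mxE; apply/eqP; rewrite -[_ == _]negbK.
(* Nearby points of the locus have a relation with nonzero coordinate [k], to which the curve
   applies. *)
have [B [B0 AxB]] := kernel_shift xt xk0 Ax.
apply: (line_vanish (B := B) (g := 'X)); first by rewrite polyX_eq0.
move=> e; rewrite hornerX => e0.
apply: (curve_case _ (x + e *: delta_mx k 0)); last exact: AxB.
- by move=> j ji; rewrite !mxE A0 // B0 // mulr0 addr0.
- by rewrite !mxE xk0 !eqxx mulr1 add0r.
- by move=> j kj; rewrite !mxE xk // add0r -val_eqE /= gtn_eqF ?mulr0.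
Qed.

Lemma vanishing_cell (k : 'I_N) :
  vanishing (double_coset (@borel F n) (@borel F n) (v_short k * w0 n)%g) =
  K_ideal k.+1.
Proof.
rewrite -vanishing_dependent //; apply/seteqP; split; last first.
  exact/vanishingS/cell_dependent.
move=> f f0 A depA; have [wk _] := w0_v_short k.
(* For [i = ord0] the condition on row 0 is empty. *)
apply: (LK_dense (i := ord0) _ wk (cell_minors_perm _) _ _ depA) => //.
by move=> B _ depB /(cell_minors_cell depB); apply: f0.
Qed.

(** Any permutation matrix sending [k] to 0 is an invertible point to which all others can be
    joined. For i > k the first k + 1 columns would be dependent in all rows, leaving no invertible
    point. *)
Lemma vanishing_LK_unit (i k : 'I_N) : (i <= k)%N ->
  vanishing [set A : 'M[F]_N | A \in unitmx /\ row0_zero i A /\ dependent 1 k.+1 A] =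
  ideal_add (L_ideal i) (K_ideal k.+1).
Proof.
move=> ik; rewrite -vanishing_LK //; apply/seteqP; split; last first.
  by apply: vanishingS => A [].
move=> f f0 A [A0 depA].
apply: (LK_dense (w := tperm k ord0) (g := \det Z) ik _ _ _ A0 depA).
  by rewrite tpermL.
  by rewrite mxeval_detZ permutation_matrixE -unitfE -unitmxE unitmx_perm.
move=> B B0 depB; rewrite mxeval_detZ -unitfE -unitmxE => uB; exact: f0.
Qed.

End Cells.

(** * The Hessenberg ideal *)

Lemma homo_ord_addn p q (c : 'I_p -> 'I_q) : {homo c : a b / (a < b)%N} ->
  forall a b : 'I_p, (a <= b)%N -> (c a + (b - a) <= c b)%N.
Proof.
move=> hc a b; move: {2}(b - a)%N (erefl (b - a)%N) => d.
elim: d b => [|d IH] b eab ab.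
  by rewrite eab addn0 (_ : b = a) //; apply: val_inj => /=; lia.
have pb : (b.-1 < p)%N by have := ltn_ord b; lia.
have := IH (Ordinal pb); have : (Ordinal pb < b)%N by rewrite /=; lia.
move/hc => /=; lia.
Qed.

Lemma enum_val_homo N (A : {set 'I_N}) :
  {homo (fun a : 'I_#|A| => enum_val a) : a b / (a < b)%N}.
Proof.
move=> a b ab; have x0 := enum_val a; rewrite !(enum_val_nth x0).
have sA : sorted ltn [seq val x | x <- enum A].
  apply: (subseq_sorted ltn_trans) (iota_ltn_sorted 0 N).
  rewrite -val_enum_ord; apply: map_subseq; rewrite [enum 'I_N]enumT.
  exact: filter_subseq.
have szA : size (enum A) = #|A| by rewrite -cardE.
have := sorted_ltn_nth ltn_trans (val x0) sA a b.
by rewrite !inE size_map szA !(nth_map x0) ?szA //; apply.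
Qed.

Section HessenbergIdeal.
Variables (F : numFieldType) (n : nat).
Local Notation N := n.+1.
Local Notation mxpol := {mpoly F[N * N]}.
Local Notation Z := (Zmx F n).
Implicit Types (f : mxpol) (h : 'I_N -> 'I_N) (i m : 'I_N).

Definition hess_matrix i m : 'M[mxpol]_(N, i.+1 + m.+1) :=
  row_mx (first_cols (map_mx (fun c => c%:MP) (s_mx F n) *m Z) i) (first_cols Z m).

Lemma hess_matrixl i m a (j : 'I_i.+1) :
  hess_matrix i m a (lshift m.+1 j) =
  if a == ord0 then Z ord0 (widen_ord (ltn_ord i) j) else 0.
Proof.
rewrite row_mxEl mxE [(_ *m _) _ _]mxE (bigD1 ord0) //= big1 ?addr0.
  rewrite [map_mx _ _ _ _]mxE [s_mx _ _ _ _]mxE andbT.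
  by case: eqP; rewrite ?mul1r // mul0r.
move=> l /negbTE l0; rewrite [map_mx _ _ _ _]mxE [s_mx _ _ _ _]mxE l0 andbF.
by rewrite mul0r.
Qed.

Lemma hess_matrixr i m a (b : 'I_m.+1) :
  hess_matrix i m a (rshift i.+1 b) = Z a (inord b).
Proof.
rewrite row_mxEr mxE; congr (Z a _); apply: val_inj => /=.
by rewrite inordK // (leq_trans (ltn_ord b)).
Qed.

Lemma hess_minor_corner i m (r : 'I_m.+2 -> 'I_N) (c : 'I_m.+2 -> 'I_(i.+1 + m.+1))
    (j : 'I_i.+1) :
  (forall b, r (lift ord0 b) != ord0) -> c ord0 = lshift m.+1 j ->
  (forall b, c (lift ord0 b) = rshift i.+1 b) ->
  \det (mxsub r c (hess_matrix i m)) =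
  (if r ord0 == ord0 then Z ord0 (widen_ord (ltn_ord i) j) else 0) *
  \det (mxsub (fun b => r (lift ord0 b)) (fun b => inord b) Z).
Proof.
move=> r0 c0 cl; rewrite (expand_det_col _ ord0) (bigD1 ord0) //= big1 ?addr0.
  rewrite mxE c0 hess_matrixl; congr (_ * _); rewrite /cofactor addn0 expr0 mul1r.
  congr (\det _); apply/matrixP => a b.
  by rewrite 3!mxE cl hess_matrixr [RHS]mxE.
move=> a; have [b ->|-> /eqP //] := unliftP ord0 a.
by move=> _; rewrite mxE c0 hess_matrixl (negbTE (r0 b)) mul0r.
Qed.

Lemma L_idealS k l : (k <= l)%N -> L_ideal k `<=` (L_ideal l : set mxpol).
Proof.
move=> kl; apply: ideal_gen_min; first exact: ideal_gen_ideal.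
by move=> _ [j jk ->]; apply: ideal_gen_sub; exists j; rewrite ?(leq_trans jk).
Qed.

Lemma p_minorE (A : {set 'I_N}) k (kA : #|A| = k) :
  p_minor F A =
  \det (mxsub (fun b => enum_val (cast_ord (esym kA) b)) (fun b => inord b) Z).
Proof.
subst k; congr (\det _); apply/matrixP => a b.
by rewrite !mxE cast_ord_id.
Qed.

(** A minor with one left column [j] is z_0j times a minor below row 0, or 0 if row 0 is not chosen.
    Conversely, putting row 0 and column [j] in front of a generator of [K_ideal] realises each
    product. *)
Lemma hess_ideal_atE h i :
  hess_ideal_at (s_mx F n) h i = ideal_gen (LK_products i.+1 (h i).+1).
Proof.
rewrite /hess_ideal_at; set m := h i; apply/seteqP; split.
  apply: (ideal_gen_min (ideal_gen_ideal _)).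
  move=> _ [r [c [hr hc ->]]].
  have [P0 PD PM] := ideal_gen_ideal (LK_products i.+1 m.+1 : set mxpol).
  rewrite -/(hess_matrix i m).
  have rI : injective r.
    move=> a b rab; apply: val_inj; have [ab|ab|//] := ltngtP a b.
      by have := hr _ _ ab; rewrite rab ltnn.
    by have := hr _ _ ab; rewrite rab ltnn.
  have cge := homo_ord_addn hc.
  (* The right block has only [m.+1] columns for a minor of size [m.+2], so the first column is a
     left one. *)
  have [j c0|b c0] := split_ordP (c ord0); last first.
    have := cge ord0 ord_max (leq0n _); rewrite c0 /= subn0.
    by have := ltn_ord (c ord_max); lia.
  (* Two left columns are both supported in row 0, so expanding along both gives 0. *)
  have [j' c1|b' c1] := split_ordP (c (lift ord0 ord0)).
    rewrite (expand_det_col _ ord0) big1 // => a _; rewrite mxE c0 hess_matrixl.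
    have [ra|_] := eqVneq (r a) ord0; last by rewrite mul0r.
    rewrite /cofactor (expand_det_col _ ord0) big1 ?mulr0 // => b _.
    rewrite 3!mxE c1 hess_matrixl -ra (inj_eq rI) eq_sym (negbTE (neq_lift a b)).
    by rewrite mul0r.
  (* The other [m.+1] columns increase strictly within a block of [m.+1], so they fill it in
     order. *)
  have cl b : c (lift ord0 b) = rshift i.+1 b.
    apply: val_inj => /=; have := cge (lift ord0 ord0) (lift ord0 b).
    rewrite c1 !lift0 => /(_ isT) /= c1b.
    have := cge (lift ord0 b) ord_max; rewrite lift0 => /(_ (ltn_ord b)) /= cb.
    have := ltn_ord (c ord_max); have := ltn_ord b; lia.
  have r0 b : r (lift ord0 b) != ord0.
    by rewrite -val_eqE /= -lt0n; apply: leq_ltn_trans (hr ord0 _ _); rewrite ?lift0.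
  rewrite (hess_minor_corner r0 c0 cl); case: eqP => _; last by rewrite mul0r.
  apply: LK_mul; first by apply: ideal_gen_sub; exists (widen_ord (ltn_ord i) j) => //=.
  by apply: minor_K_ideal => b; rewrite lt0n; apply: r0.
apply: ideal_gen_min => [|_ [j ji [A [A0 kA ->]]]]; first exact: ideal_gen_ideal.
pose rA (b : 'I_m.+1) : 'I_N := enum_val (cast_ord (esym kA) b).
have rA0 b : rA b != ord0.
  by apply: contraNneq A0 => <-; apply: enum_valP.
pose r a := if unlift ord0 a is Some b then rA b else ord0.
pose c a := if unlift ord0 a is Some b then rshift i.+1 b else lshift m.+1 (Ordinal ji).
have rl b : r (lift ord0 b) = rA b by rewrite /r liftK.
have cl b : c (lift ord0 b) = rshift i.+1 b by rewrite /c liftK.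
have c0 : c ord0 = lshift m.+1 (Ordinal ji) by rewrite /c unlift_none.
apply: ideal_gen_sub; exists r, c; split.
- move=> a b; rewrite /r; case: (unliftP ord0 b) => [b' ->|-> //].
  case: (unliftP ord0 a) => [a' ->|->] ab; last by have := rA0 b'; rewrite -ord_gt0.
  by apply: enum_val_homo; move: ab; rewrite !lift0.
- move=> a b; rewrite /c; case: (unliftP ord0 b) => [b' ->|-> //].
  by case: (unliftP ord0 a) => [a' ->|->]; rewrite ?lift0 /=; [lia|lia].
have r0 b : r (lift ord0 b) != ord0 by rewrite rl.
have r00 : r ord0 = ord0 by rewrite /r unlift_none.
rewrite -/(hess_matrix i m) (hess_minor_corner r0 c0 cl) r00 eqxx (p_minorE kA).
congr (_ * _); first by congr (Z _ _); apply: val_inj.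
by congr (\det _); apply/matrixP => a b; rewrite [RHS]mxE rl mxE.
Qed.

(* Laplace expansion along the last column. *)
Lemma K_idealS k l : (k <= l)%N -> K_ideal l `<=` (K_ideal k : set mxpol).
Proof.
move=> kl; rewrite -(subnK kl); elim: (l - k)%N => // {l kl}d IH f /K_ideal_minor.
have [_ _ KM] := ideal_gen_ideal [set f | exists A : {set 'I_N},
  [/\ ord0 \notin A, #|A| = k & f = p_minor F A]].
apply: ideal_gen_min; first exact: ideal_gen_ideal.
move=> _ [rho rho0 ->]; rewrite (expand_det_col _ ord_max).
apply: is_ideal_sum => [|a _]; first exact: ideal_gen_ideal.
apply/KM; rewrite /cofactor; apply/KM/IH.
have := @minor_K_ideal F n (d + k) (fun b => rho (lift a b)) (fun b => rho0 _).
congr (K_ideal _ (\det _)); apply/matrixP => b c; rewrite [LHS]mxE 3![RHS]mxE.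
by congr (Z _ (inord _)); rewrite lift_max.
Qed.

Lemma L_ideal0 (I : set mxpol) : is_ideal I -> L_ideal 0 `<=` I.
Proof. by move=> idI; apply: ideal_gen_min => // f []. Qed.

Lemma K_ideal_full (I : set mxpol) : is_ideal I -> K_ideal N `<=` I.
Proof.
move=> idI; apply: ideal_gen_min => // f [A [A0 NA _]].
have AT : A = [set: 'I_N]%SET.
  by apply/eqP; rewrite eqEcard finset.subsetT cardsT card_ord NA /=.
by rewrite AT inE in A0.
Qed.

(** In indices starting at 1 this is L_(i-1) + K_(h(i)). *)
Definition LK h i : set mxpol := ideal_add (L_ideal i) (K_ideal (h i).+1).

Lemma LK_ideal h i : is_ideal (LK h i).
Proof. by apply: ideal_add_ideal; apply: ideal_gen_ideal. Qed.

Lemma hessenberg_homo h : hessenberg h -> {homo h : i j / (i <= j)%N}.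
Proof.
move=> [_ hS] i j; move: {2}(j - i)%N (erefl (j - i)%N) => d.
elim: d j => [|d IH] j ed ij.
  by rewrite (_ : j = i) //; apply: val_inj => /=; lia.
have pj : (j.-1 < N)%N by have := ltn_ord j; lia.
apply: leq_trans (IH (Ordinal pj) _ _) (hS (Ordinal pj) j _); rewrite /=; lia.
Qed.

(** A product at [t] has its L-factor in [L_ideal i] if t < i, and its K-factor in
    [K_ideal (h i).+1] otherwise, by monotonicity of [h]. *)
Lemma hess_ideal_sub_LK h i : hessenberg h -> hess_ideal (s_mx F n) h `<=` LK h i.
Proof.
move=> hh; have idLK := LK_ideal h i; apply: ideal_sum_min => // t.
rewrite hess_ideal_atE; apply: LK_products_sub => //.
have [ti|it] := ltnP t i; [left|right].
  by apply: subset_trans (L_idealS ti) (ideal_add_subl (ideal_gen_ideal _)).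
apply: subset_trans (ideal_add_subr (ideal_gen_ideal _)).
by apply: K_idealS; rewrite ltnS; apply: hessenberg_homo.
Qed.

(** If [i] is not a corner, [h] agrees at [i] and its predecessor, whose ideal is then contained in
    that of [i]. *)
Lemma corner_LK h i f : hessenberg h ->
  (forall j, corner h j -> LK h j f) -> LK h i f.
Proof.
move=> hh Cf; have [m] := ubnP (val i); elim: m i => // m IH i /ltnSE im.
have [|/existsNP [j /not_implyP [ij /negP hji]]] := pselect (corner h i); first exact: Cf.
have hE : h i = h j.
  apply: val_inj; apply/eqP; rewrite eqn_leq (hh.2 j i ij) andbT.
  by rewrite leqNgt.
have : LK h j f by apply: IH; rewrite /= -ij.
rewrite /LK hE; apply: ideal_addS => //; apply: L_idealS; lia.
Qed.

(* The ideals L_i increase and the ideals K_(h i) decrease with i, so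
   intersecting with one more L_i + K_(h i) replaces the summand K_(h (i-1)) by
   (K_(h (i-1)) :&: L_i) + K_(h i). *)
Lemma hess_idealE h : hessenberg h ->
  hess_ideal (s_mx F n) h = \bigcap_(i in corner h) LK h i.
Proof.
move=> hh; apply/seteqP; split=> [f If i _|f Cf]; first exact: hess_ideal_sub_LK.
pose I := hess_ideal (s_mx F n) h.
have idat i : is_ideal (hess_ideal_at (s_mx F n) h i) by apply: ideal_gen_ideal.
have idI : is_ideal I := ideal_sum_ideal idat.
have LKf i : LK h i f by apply: corner_LK.
(* Membership in [I] plus [K_ideal (h i).+1] is proved for every [i] in turn; at the last index the
   second ideal is zero. *)
have : ideal_add I (K_ideal (h ord_max).+1) f.
  move: (ord_max) => i; have [m] := ubnP (val i).
  elim: m i => // m IH [[|p] pN] /= im.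
    apply: ideal_addS (LKf (Ordinal pN)) => //; exact: L_ideal0.
  have pN' := ltnW pN.
  have [a [b [Ia Kb ef]]] := IH (Ordinal pN') im.
  have [_ LKD _] := LK_ideal h (Ordinal pN).
  have [l [k [Ll Kk eb]]] : LK h (Ordinal pN) b.
    have -> : b = f - a by rewrite ef addrAC subrr add0r.
    by apply: is_idealB => //; [exact: LK_ideal|exact: hess_ideal_sub_LK].
  exists (a + l), k; split=> //; last by rewrite ef eb addrA.
  have [_ ID _] := idI; apply: ID => //.
  apply: (ideal_sum_sub (t := Ordinal pN') idat); rewrite hess_ideal_atE.
  (* Both [b] and [k] lie in the larger ideal K of the previous index, hence so does [l], which also
     lies in L. *)
  apply: LK_inter; split=> //.
  have -> : l = b - k by rewrite eb addrK.
  apply: is_idealB => //; first exact: ideal_gen_ideal.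
  by apply: K_idealS Kk; rewrite ltnS; apply: hessenberg_homo => //=.
have -> : h ord_max = ord_max.
  by apply/val_inj/eqP; rewrite eqn_leq -ltnS ltn_ord hh.1.
by apply: ideal_add_min => //; apply: K_ideal_full.
Qed.

End HessenbergIdeal.

(** * Saturation and flag varieties *)

Section SaturationFlags.
Variables (F : numFieldType) (n : nat).
Local Notation N := n.+1.
Local Notation mxpol := {mpoly F[N * N]}.
Local Notation Z := (Zmx F n).
Implicit Types (f : mxpol) (A g : 'M[F]_N) (h : 'I_N -> 'I_N) (i : 'I_N).

(** A combination over the localized ring has a common denominator, a power of the determinant, and
    a numerator in [I]; clearing it in the fraction field puts [f] times that power in [I]. *)
Lemma saturation_id (I : set mxpol) : is_ideal I ->
  (forall f k, I (f * \det Z ^+ k) -> I f) -> saturation I = I.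
Proof.
move=> [I0 ID IM] Isat; apply/seteqP; split=> [f [s [Is fE]]|f If]; last first.
  exists [:: (1, tofrac f)]; rewrite big_seq1 mul1r; split=> // y.
  rewrite inE => /eqP -> /=; split; last by exists f.
  by exists 1, 0%N; rewrite expr0 divr1 tofrac1.
have d0 : tofrac (\det Z) != 0.
  rewrite tofrac_eq0; apply/eqP => d0; have := mxeval_detZ (1%:M : 'M[F]_N).
  by rewrite d0 /mxeval meval0 det1 => /eqP; rewrite eq_sym oner_eq0.
have [g [k [Ig sE]]] : exists (g : mxpol) k, I g /\
    \sum_(y <- s) y.1 * y.2 = tofrac g / tofrac (\det Z) ^+ k.
  elim: s Is {fE} => [|[y1 y2] s IH] Is.
    by exists 0, 0%N; rewrite big_nil tofrac0 mul0r.
  have [|g [k [Ig sE]]] := IH; first by move=> y ys; apply: Is; rewrite inE ys orbT.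
  have [[a [l /= ->]] [b Ib /= <-]] := Is (y1, y2) (mem_head _ _).
  exists (a * b * \det Z ^+ k + g * \det Z ^+ l), (l + k)%N; split.
    by apply: ID; rewrite mulrC; apply: (IM) => //; apply: IM.
  rewrite big_cons /= sE tofracD !tofracM !tofracXn.
  by rewrite mulrAC addf_div ?expf_neq0 // exprD.
apply: (Isat f k); suff -> : f * \det Z ^+ k = g by [].
apply/eqP; rewrite -tofrac_eq tofracM tofracXn fE sE.
by rewrite divfK ?expf_neq0.
Qed.

(** Outside every zero locus, choose in each ideal a polynomial nonzero at [A]; their finite product
    lies in all the ideals and is nonzero at [A]. *)
Lemma zeros_bigcap (T : finType) (P : set T) (I : T -> set mxpol) :
  (forall t, is_ideal (I t)) ->
  zeros (\bigcap_(t in P) I t) = \bigcup_(t in P) zeros (I t).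
Proof.
move=> idI; apply/seteqP; split=> [A A0|A [t Pt At] f f0]; last by apply/At/f0.
apply: contrapT => nA.
have /choice [f Hf] : forall t, exists f, P t -> I t f /\ mxeval f A != 0.
  move=> t; have [Pt|] := pselect (P t); last by exists 0.
  have : ~ zeros (I t) A by move=> At; apply: nA; exists t.
  by move=> /existsNP [f /not_implyP [If /eqP f0]]; exists f.
pose g t := if asbool (P t) then f t else 1.
have := A0 (\prod_t g t); rewrite /mxeval rmorph_prod /= => H.
have /eqP : \prod_t (g t).@[fun k => mxvec A 0 k] = 0.
  apply: H => t Pt; rewrite (bigD1 t) //= mulrC; have [_ _ IM] := idI t.
  by apply: IM; rewrite /g asboolT //; have [] := Hf t Pt.
apply/negP/prodf_neq0 => t _; rewrite /g; case: asboolP => [/Hf []//|_].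
by rewrite meval1 oner_eq0.
Qed.

(** * Closures in the flag variety and Richardson schemes *)

Lemma borel1 : borel (1%:M : 'M[F]_N).
Proof. by split; rewrite ?unitmx1 // trmx1 scalar_mx_is_trig. Qed.

(* B-stability makes the set of cosets of the invertible points of D closed. *)
Lemma flag_closureE (S D : set 'M[F]_N) g : S `<=` [set A | A \in unitmx] ->
  zclosure S = D -> (forall A b, borel b -> D A -> D (A *m b)) -> g \in unitmx ->
  flag_closure (@coset_borel F n @` S) (coset_borel g) <-> D g.
Proof.
move=> uS SD DB ug.
have SsubD : S `<=` D by rewrite -SD => A SA f; apply.
split=> [clg|Dg K [[Ku [E [I EI] KE]] SK]].
  (* This set is closed and contains the cosets of [S], so it bounds the closure from above. *)
  pose K := @coset_borel F n @` [set A | A \in unitmx /\ D A].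
  have KD A : A \in unitmx -> (K (coset_borel A) <-> D A).
    move=> uA; split=> [[A' [uA' DA']] eA|DA]; last by exists A.
    have : coset_borel A A by exists 1%:M; rewrite ?mulmx1; [exact: borel1|].
    by rewrite -eA => -[b bb ->]; apply: DB.
  apply/KD => //; apply: clg; split; last first.
    by move=> _ [A SA <-]; exists A => //; split; [exact: uS|exact: SsubD].
  split; first by move=> _ [A [uA _] <-]; exists A.
  by exists D => //; exists (vanishing S); rewrite -SD.
(* Conversely, the equations of any closed set containing these cosets vanish on [S], hence on its
   closure [D]. *)
apply/KE => //; rewrite EI => f If; move: Dg; rewrite -SD; apply=> A SA.
have : E A by apply/KE; [exact: uS|apply: SK; exists A].
by rewrite EI; apply.
Qed.

Lemma row0_zero_borel k A b : borel b -> row0_zero k A -> row0_zero k (A *m b).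
Proof.
move=> bb A0 j jk; rewrite mxE big1 // => l _; have [lk|kl] := ltnP l k.
  by rewrite A0 ?mul0r.
by rewrite (borelE bb) ?mulr0 // (leq_trans jk).
Qed.

Lemma dependent_borel r k A b : borel b -> dependent r k A -> dependent r k (A *m b).
Proof.
move=> bb [x x0 [xk Ax]]; have bV := borel_invmx bb; have ub := bb.1.
exists (invmx b *m x).
  by apply: contraNneq x0 => /(congr1 (mulmx b)); rewrite mulKVmx // mulmx0 => ->.
split=> [j kj|i ri]; last by rewrite -mulmxA mulKVmx // Ax.
rewrite mxE big1 // => l _; have [lk|kl] := ltnP l k; last by rewrite xk ?mulr0.
by rewrite (borelE bV) ?mul0r // (leq_trans lk).
Qed.

Lemma double_coset_unit (P Q : set 'M[F]_N) w :
  P `<=` [set A | A \in unitmx] -> Q `<=` [set A | A \in unitmx] ->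
  double_coset P Q w `<=` [set A | A \in unitmx].
Proof.
move=> uP uQ _ [a [b [/uP /= ua /uQ /= ub ->]]] /=.
by rewrite !unitmx_mul ua ub permutation_matrixE unitmx_perm.
Qed.

Lemma matrix_schubert_opE i : matrix_schubert_op (u_short i) = row0_zero i :> set 'M[F]_N.
Proof. by rewrite /matrix_schubert_op /zclosure vanishing_op_cell zeros_L_ideal. Qed.

Lemma matrix_schubertE i : matrix_schubert (v_short i * w0 n)%g =
  [set A : 'M[F]_N | dependent 1 i.+1 A].
Proof. by rewrite /matrix_schubert /zclosure vanishing_cell zeros_K_ideal. Qed.

Lemma schubert_opE i g : g \in unitmx ->
  schubert_op (u_short i) (coset_borel g) <-> row0_zero i g.
Proof.
apply: flag_closureE; first by apply: double_coset_unit => A [].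
  exact: matrix_schubert_opE.
by move=> A b; apply: row0_zero_borel.
Qed.

Lemma schubertE i g : g \in unitmx ->
  schubert (v_short i * w0 n)%g (coset_borel g) <-> dependent 1 i.+1 g.
Proof.
apply: (@flag_closureE _ [set A : 'M[F]_N | dependent 1 i.+1 A]).
- by apply: double_coset_unit => A [].
- exact: matrix_schubertE.
- by move=> A b; apply: dependent_borel.
Qed.

Lemma LK_richardson h i : (i <= h i)%N ->
  is_matrix_richardson_scheme (LK h i : set mxpol).
Proof.
move=> ihi; exists (u_short i), (v_short (h i) * w0 n)%g; split.
  (* The permutation matrix of [w] lies in both: its row 0 has its 1 in column [h i], not before
     column [i]. *)
  have [wk _] := w0_v_short (h i); set w := (v_short (h i) * w0 n)%g in wk *.
  have uP : permutation_matrix F w \in unitmx by rewrite permutation_matrixE unitmx_perm.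
  exists (coset_borel (permutation_matrix F w)); split.
    apply/schubert_opE => // j ji.
    by rewrite mxE -wk (inj_eq perm_inj) -val_eqE /= ltn_eqF // (leq_trans ji).
  apply/schubertE => //; apply: cell_dependent; exists 1%:M, 1%:M.
  by rewrite mulmx1 mul1mx; split=> //; exact: borel1.
rewrite /variety /matrix_richardson vanishing_zclosure /LK -vanishing_LK_unit //.
congr vanishing; apply/seteqP; split=> A [uA].
  by move=> [A0 depA]; split=> //; split; [apply/schubert_opE|apply/schubertE].
by move=> [/schubert_opE A0 /schubertE depA]; split=> //; split; [exact: A0|exact: depA].
Qed.

(** [LK h i] is the vanishing ideal of a set of invertible matrices, where [g] can be cancelled
    pointwise. *)
Lemma LK_power h i f (g : mxpol) k : (i <= h i)%N -> LK h i (f * g ^+ k) ->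
  (forall A, A \in unitmx -> mxeval g A != 0) -> LK h i f.
Proof.
move=> ihi; rewrite /LK -vanishing_LK_unit // => fg0 g0 A VA.
have := fg0 A VA; rewrite /mxeval mevalM rmorphXn => /eqP.
by rewrite mulf_eq0 expf_eq0 (negbTE (g0 A VA.1)) andbF orbF => /eqP.
Qed.

Lemma LK_reduced h i f k : (i <= h i)%N -> LK h i (f ^+ k) -> LK h i f.
Proof.
move=> ihi; rewrite /LK -vanishing_LK_unit // => f0 A VA.
have := f0 A VA; rewrite /mxeval rmorphXn => /eqP.
by rewrite expf_eq0 => /andP [_ /eqP].
Qed.

End SaturationFlags.

(* MathComp multiplies permutations left to right: (v * w0)%g is the
   composite w0 o v. The ordinal i is the mathematical index i.+1. *)
Theorem theorem4p1 (R : realType) (n : nat) (h : 'I_n.+1 -> 'I_n.+1)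
    (hess_h : hessenberg h) :
  let s : 'M[complex R]_n.+1 := s_mx (complex R) n in
  let Y := matrix_hessenberg_scheme s h in
  let Xop (i : 'I_n.+1) : set 'M[complex R]_n.+1 :=
    matrix_schubert_op (u_short i) in
  let X (i : 'I_n.+1) : set 'M[complex R]_n.+1 :=
    matrix_schubert (v_short (h i) * w0 n)%g in
  [/\ reduced_scheme Y,
      zeros Y = \bigcup_(i in corner h) (Xop i `&` X i),
      Y = scheme_union (corner h)
            (fun i => scheme_inter (variety (Xop i)) (variety (X i)))
    & forall i, corner h i ->
        is_matrix_richardson_scheme
          (scheme_inter (variety (Xop i)) (variety (X i)))] /\
  (saturation (hess_ideal s h) = hess_ideal s h /\
   hess_ideal s h =
     \bigcap_(i in corner h) ideal_add (L_ideal i) (K_ideal (h i).+1)).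
Proof.
move=> s Y Xop X; pose F : numFieldType := complex R.
have ihi (i : 'I_n.+1) : (i <= h i)%N := hess_h.1 i.
have hessE : hess_ideal s h = \bigcap_(i in corner h) (LK h i : set {mpoly F[_]}).
  exact: (@hess_idealE F).
have satE : saturation (hess_ideal s h) = hess_ideal s h.
  apply: (@saturation_id F) => [|f k].
    by apply: ideal_sum_ideal => i; apply: ideal_gen_ideal.
  rewrite hessE => If i Ci; apply: (LK_power (ihi i) (If i Ci)) => A.
  by rewrite mxeval_detZ unitmxE unitfE.
have YE : Y = \bigcap_(i in corner h) (LK h i : set {mpoly F[_]}).
  by rewrite /Y /matrix_hessenberg_scheme satE.
(* Taking closures does not change vanishing ideals, so the two summands are those of the cells,
   namely L and K. *)
have LKE i : scheme_inter (variety (Xop i)) (variety (X i)) = LK h i.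
  rewrite /scheme_inter /variety /Xop /X !(@vanishing_zclosure F).
  by rewrite (@vanishing_op_cell F) (@vanishing_cell F).
split; last by split; [exact: satE|rewrite hessE].
split.
- move=> f k; rewrite YE => Yf i Ci; exact: LK_reduced (ihi i) (Yf i Ci).
- rewrite YE zeros_bigcap; last exact: LK_ideal.
  apply: eq_bigcupr => i _; rewrite zeros_ideal_add; try exact: ideal_gen_ideal.
  rewrite /Xop /X (@matrix_schubert_opE F) (@matrix_schubertE F).
  by rewrite zeros_L_ideal zeros_K_ideal.
- by rewrite YE; apply: eq_bigcapr => i _; rewrite LKE.
- by move=> i _; rewrite LKE; apply: LK_richardson.
Qed.
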